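(* Let $\rho>0$ and let $p_{_{PS}}(t)=\sum_{n=0}^\infty\frac{\rho^n}{n!}e^{-\rho}p_n(t)$ be the unconditional sojourn time density in the $M/M/1$ processor sharing queue with balking $b_n=1/(n+1)$ (service rate $1$, arrival rate $\rho$), where $p_n(t)$ is the conditional sojourn time density. Then $$p_{_{PS}}(t)=\sum_{m=1}^\infty C_m(\nu_m)\,\Phi_m(\nu_m)\,e^{\nu_m t}+\sum_{m=1}^\infty C_m(\widetilde{\nu}_m)\,\Phi_m(\widetilde{\nu}_m)\,e^{\widetilde{\nu}_m t},$$ where $$\Phi_m(\nu)=e^{-\rho}(-\nu)^{m-1}\exp\Big(\frac{\rho}{\nu+1}\Big),\qquad C_m(\nu)=\frac{m^{m-1}}{m!}\,\frac{\nu}{\nu-1}\,e^{-m},$$ $$\nu_m=-1+\frac{1}{2m}\Big[-\rho+\sqrt{\rho^2+4m\rho}\Big],\qquad \widetilde{\nu}_m=-1+\frac{1}{2m}\Big[-\rho-\sqrt{\rho^2+4m\rho}\Big].$$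
   Context: $\mathcal{V}_n$ denotes the sojourn time of a tagged customer who enters the PS queue and finds $n$ other customers present, and $\mathbf{V}_n(t)=\mathrm{Prob}[\mathcal{V}_n>t]$. With $b_n=1/(n+1)$, the functions $\mathbf{V}_n$ ($n\ge 0$, $t\ge 0$, $0\le \mathbf V_n\le 1$) are the bounded solution of $$\mathbf{V}'_n(t)=\frac{n}{n+1}\mathbf{V}_{n-1}(t)-\Big(1+\frac{\rho}{n+1}\Big)\mathbf{V}_n(t)+\frac{\rho}{n+1}\mathbf{V}_{n+1}(t),\qquad \mathbf{V}_n(0)=1.$$ The conditional sojourn time density is $p_n(t)=-\mathbf{V}_n'(t)$; equivalently $$p'_n(t)=\frac{n}{n+1}p_{n-1}(t)-\Big(1+\frac{\rho}{n+1}\Big)p_n(t)+\frac{\rho}{n+1}p_{n+1}(t),\quad t>0,\qquad p_n(0)=\frac{1}{n+1},\quad n\ge 0$$ (the term with $p_{n-1}$ is absent for $n=0$). The unconditional density $p_{_{PS}}$ is by definition the Poisson($\rho$) mixture displayed in the claim. *)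

(* Defs.v *)
From Stdlib Require Export Reals Factorial.
From Coquelicot Require Export Coquelicot.

Open Scope R_scope.

(* f'(t) = l for f considered on [0, +oo) only: this is [is_derive f t l] with
   [locally t] replaced by the neighbourhoods of t in [0, +oo), so it is a
   one-sided derivative at t = 0 and the usual derivative at t > 0. *)
Definition is_derive_nonneg (f : R -> R) (t l : R) : Prop :=
  filterdiff f (within (fun s => 0 <= s) (locally t)) (fun h => scal h l).

(* V n t = Prob[V_n > t], the tail of the sojourn time of a tagged customer who
   finds n other customers present, for the balking probabilities
   b_n = 1 / (n + 1): V is a solution of the backward equations, on t >= 0,
   bounded by 0 and 1 uniformly in n and t.  For n = 0 the term V (n - 1) is
   absent because its coefficient is 0. *)
Record is_sojourn_tail (rho : R) (V : nat -> R -> R) : Prop := {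
  sojourn_tail_bounded : forall n t, 0 <= t -> 0 <= V n t <= 1;
  sojourn_tail_init : forall n, V n 0 = 1;
  sojourn_tail_ode : forall n t, 0 <= t ->
    is_derive_nonneg (V n) t
      (INR n / (INR n + 1) * V (n - 1)%nat t
       - (1 + rho / (INR n + 1)) * V n t
       + rho / (INR n + 1) * V (n + 1)%nat t)
}.

(* p n = - V_n' on [0, +oo). *)
Definition is_sojourn_density (V p : nat -> R -> R) : Prop :=
  forall n t, 0 <= t -> is_derive_nonneg (V n) t (- p n t).

Definition p_PS_term (rho : R) (p : nat -> R -> R) (t : R) (n : nat) : R :=
  rho ^ n / INR (fact n) * exp (- rho) * p n t.

Definition p_PS (rho : R) (p : nat -> R -> R) (t : R) : R :=
  Series (p_PS_term rho p t).

Definition Phi (rho : R) (m : nat) (nu : R) : R :=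
  exp (- rho) * (- nu) ^ (m - 1) * exp (rho / (nu + 1)).

Definition C_coef (m : nat) (nu : R) : R :=
  INR m ^ (m - 1) / INR (fact m) * (nu / (nu - 1)) * exp (- INR m).

Definition nu_plus (rho : R) (m : nat) : R :=
  -1 + 1 / (2 * INR m) * (- rho + sqrt (rho ^ 2 + 4 * INR m * rho)).

Definition nu_minus (rho : R) (m : nat) : R :=
  -1 + 1 / (2 * INR m) * (- rho - sqrt (rho ^ 2 + 4 * INR m * rho)).

Definition spectral_term (rho : R) (nu : nat -> R) (t : R) (m : nat) : R :=
  C_coef m (nu m) * Phi rho m (nu m) * exp (nu m * t).

(* Main.v *)
Require Import Defs.
From Stdlib Require Import Reals Lra Lia.
From Coquelicot Require Import Coquelicot.
Open Scope R_scope.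

(** Write [d = 1 + nu]; then [nu_plus rho m] and [nu_minus rho m] correspond to the
two roots [d] of [m d^2 + rho d = rho].  Let [A] be the matrix of the backward
equations.  For such a root, the Taylor coefficients [c_n] of
[G(x) = e^{(rho+d)x} (e^{dx}(1-dx))^{m-1}], which is also
[e^{rho x/d} (1-dx)^{m-1}], make the row vector [(n+1) c_n] a left eigenvector
of [A] with eigenvalue [nu] ([mode_coef_left_eigenvector]).  As
[p_n(0) = 1/(n+1)], pairing it with [p(t)] gives
[sum_n (n+1) c_n p_n(t) = e^{nu t} sum_n c_n = e^{nu t} G(1)]
([eigen_functional]), and [G(1) = e^rho Phi_m(nu)].  So everything reduces to
expanding the Poisson mixture in these eigenvectors ([eigen_expansion]):
[rho^n/(n+1)! = sum_m (m^{m-1} e^{-m}/m!) sum_d (nu/(nu-1)) c_n].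
Multiplying by [(n+1) p_n(t)], summing over [n] and exchanging the two sums is
the theorem.  The exchange is allowed because [p] is bounded, the weights
[m^{m-1} e^{-m}/m!] are summable, and [sum_n (n+1)|c_n|] is bounded uniformly
in [m]: [e^{dx}(1-dx)] is [1 + O(d^2)] while [m d^2] stays bounded.

For the expansion, note that [G(x) = e^{rho x} E_m(-m d x)], where
[E_m(y) = e^{-y}(1+y/m)^{m-1}] has coefficients [a_n(m)] that do not depend on
[d].  Summed over the two roots with weights [nu/(nu-1)], the powers
[(-m d)^j] become polynomials [L_j] in [m] with [L_0 = 1], [L_1 = rho],
[L_{j+2} = rho L_{j+1} + rho m L_j], of degree at most [j/2] in [m].  What is
needed are therefore the sums of [(m^{m-1} e^{-m}/m!) m^i a_n(m)] over [m] for
[2i <= n].  The differential equation of [E_m] gives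
[m (n+1) a_{n+1} = -(n+1) a_n - a_{n-1}], so a factor [m] can be traded for a
lower index; by induction the sums vanish for [i >= 1] as soon as those for
[i = 0] equal [(-1)^n/(n+1)!] ([borel_abel_sum]).

This last family is Abel's identity for
[sum_m (m+y)^{m-1} z^m/m!], expanded in [y], at the critical point [z = 1/e] of
the tree function [T(z) = sum_m m^{m-1} z^m/m!].  For [z = u e^{-u}] with
[0 <= u < 1] one has [T(z) = u] ([tree_fun_x_exp_neg_x]), and the recurrence of
[a_n], read as a differential equation in [u], evaluates all the series in
closed form ([abel_tree_fun]); then [u] tends to [1] by dominated convergence. *)

(** * Dominated convergence for series *)

(** Equations produced by the generic algebraic hierarchy live in a carrier that
    only unfolds to [R]; [ring] and [field] need the type to be [R] itself. *)
Ltac as_real := match goal with |- @eq _ ?a ?b => change (@eq R a b) end.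

Lemma ex_series_dominated (a g : nat -> R) :
  (forall n, Rabs (a n) <= g n) -> ex_series g -> ex_series a.
Proof. intros H Hg; apply (ex_series_le a g); [exact H | exact Hg]. Qed.

Lemma sum_n_succ (a : nat -> R) (N : nat) : sum_n a (S N) = sum_n a N + a (S N).
Proof. apply (sum_Sn (G := R_AbelianMonoid)). Qed.

Lemma sum_n_is_lim (N : nat) (f : nat -> nat -> R) (l : nat -> R) :
  (forall m, is_lim_seq (fun k => f k m) (l m)) ->
  is_lim_seq (fun k => sum_n (f k) N) (sum_n l N).
Proof.
  intros H; induction N as [|N IH].
  - rewrite sum_O. apply is_lim_seq_ext with (fun k => f k 0%nat); [|apply H].
    intros k; now rewrite sum_O.
  - rewrite sum_Sn. apply is_lim_seq_ext with (fun k => sum_n (f k) N + f k (S N)).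
    + intros k; now rewrite sum_Sn.
    + apply is_lim_seq_plus'; [exact IH | apply H].
Qed.

Lemma Series_split (a : nat -> R) (N : nat) :
  ex_series a -> Series a = sum_n a N + Series (fun k => a (S N + k)%nat).
Proof.
  intros H. rewrite (Series_incr_n a (S N)); [|lia|exact H].
  simpl pred. now rewrite sum_n_Reals.
Qed.

Lemma Rabs_Series_dominated (a g : nat -> R) :
  (forall n, Rabs (a n) <= g n) -> ex_series g ->
  Rabs (Series a) <= Series g.
Proof.
  intros H Hg.
  assert (Ha : ex_series (fun n => Rabs (a n))).
  { apply ex_series_dominated with g; [|exact Hg].
    intros n; rewrite Rabs_Rabsolu; apply H. }
  apply Rle_trans with (1 := Series_Rabs a Ha).
  apply Series_le; [|exact Hg]. intros n; split; [apply Rabs_pos | apply H].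
Qed.

(** Tannery's theorem: beyond a large index both series are controlled by the tail
    of [g], and below it only finitely many limits are taken. *)
Lemma is_lim_seq_Series_dominated (f : nat -> nat -> R) (l g : nat -> R) :
  ex_series g ->
  (forall k m, Rabs (f k m) <= g m) ->
  (forall m, is_lim_seq (fun k => f k m) (l m)) ->
  is_lim_seq (fun k => Series (f k)) (Series l).
Proof.
  intros Hg Hf Hl.
  assert (Hlg : forall m, Rabs (l m) <= g m).
  { intros m.
    apply (is_lim_seq_le (fun k => Rabs (f k m)) (fun _ => g m) (Rabs (l m)) (g m)).
    - intros k; apply Hf.
    - apply is_lim_seq_abs with (l := l m), Hl.
    - apply is_lim_seq_const. }
  assert (Ef : forall k, ex_series (f k)).
  { intros k; apply ex_series_dominated with g; auto. }
  assert (El : ex_series l) by (apply ex_series_dominated with g; auto).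
  apply is_lim_seq_spec. intros eps. simpl.
  assert (He : 0 < eps / 4) by (destruct eps; simpl; lra).
  assert (HG : is_lim_seq (sum_n g) (Series g)) by (apply Series_correct, Hg).
  apply is_lim_seq_spec in HG. destruct (HG (mkposreal _ He)) as [M HM].
  specialize (HM M (le_n M)). simpl in HM.
  assert (Htail : forall a, (forall m, Rabs (a m) <= g m) ->
    Rabs (Series (fun k => a (S M + k)%nat)) < eps / 4).
  { intros a Ha.
    apply Rle_lt_trans with (Series (fun k => g (S M + k)%nat)).
    - apply Rabs_Series_dominated; [intros n; apply Ha|].
      now apply (ex_series_incr_n g (S M)).
    - rewrite (Series_split g M Hg) in HM.
      replace (sum_n g M - (sum_n g M + Series (fun k => g (S M + k)%nat)))
        with (- Series (fun k => g (S M + k)%nat)) in HM by ring.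
      rewrite Rabs_Ropp in HM. apply Rle_lt_trans with (2 := HM), Rle_abs. }
  pose proof (sum_n_is_lim M f l Hl) as HS.
  apply is_lim_seq_spec in HS. destruct (HS (mkposreal _ He)) as [K HK].
  exists K. intros k Hk. specialize (HK k Hk). simpl in HK.
  rewrite (Series_split (f k) M (Ef k)), (Series_split l M El).
  pose proof (Htail _ (Hf k)) as T1. pose proof (Htail _ Hlg) as T2.
  apply Rabs_def2 in HK. apply Rabs_def2 in T1. apply Rabs_def2 in T2.
  apply Rabs_def1; lra.
Qed.

Lemma is_series_sum_n (N : nat) (x : nat -> nat -> R) (l : nat -> R) :
  (forall n, (n <= N)%nat -> is_series (x n) (l n)) ->
  is_series (fun m => sum_n (fun n => x n m) N) (sum_n l N).
Proof.
  induction N as [|N IH]; intros H.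
  - rewrite sum_O. apply is_series_ext with (x 0%nat); [|apply H; lia].
    intros m; now rewrite sum_O.
  - rewrite sum_Sn.
    apply is_series_ext with (fun m => plus (sum_n (fun n => x n m) N) (x (S N) m)).
    + intros m; now rewrite sum_Sn.
    + apply (is_series_plus (K := R_AbsRing) (V := R_NormedModule)).
      * apply IH; intros n Hn; apply H; lia.
      * apply H; lia.
Qed.

(** The partial sums over the rows are series over the columns dominated by [g],
    so the exchange is an instance of dominated convergence. *)
Lemma is_series_swap (x : nat -> nat -> R) (r c g : nat -> R) :
  (forall n, is_series (x n) (r n)) ->
  (forall m, is_series (fun n => x n m) (c m)) ->
  (forall N m, sum_n (fun n => Rabs (x n m)) N <= g m) -> ex_series g ->
  is_series r (Series c).
Proof.
  intros Hr Hc Hg Eg.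
  assert (H : is_lim_seq (fun N => Series (fun m => sum_n (fun n => x n m) N)) (Series c)).
  { apply is_lim_seq_Series_dominated with g; [exact Eg| |].
    - intros N m. apply Rle_trans with (2 := Hg N m).
      apply (norm_sum_n_m (K := R_AbsRing) (V := R_NormedModule) (fun n => x n m) 0 N).
    - intros m; apply Hc. }
  apply (is_lim_seq_ext _ (sum_n r)) in H; [exact H|].
  intros N. apply is_series_unique, is_series_sum_n. intros n _; apply Hr.
Qed.

(** * Entire power series and their l1 norms *)

Definition entire (a : nat -> R) (f : R -> R) : Prop :=
  forall x, is_pseries a x (f x).

Lemma entire_is_series a f x : entire a f -> is_series (fun n => a n * x ^ n) (f x).
Proof. intros H. exact (proj1 (is_pseries_R a x (f x)) (H x)). Qed.

Lemma entire_CV_radius a f : entire a f -> CV_radius a = p_infty.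
Proof.
  intros H. pose proof (CV_radius_ge_0 a) as H0.
  destruct (CV_radius a) as [r| |] eqn:E; [exfalso | reflexivity | easy].
  simpl in H0.
  apply (CV_disk_outside a (r + 1)).
  - rewrite E. simpl. rewrite Rabs_pos_eq; lra.
  - apply ex_series_lim_0.
    exists (f (r + 1)). now apply entire_is_series.
Qed.

Lemma entire_inside a f x : entire a f -> Rbar_lt (Rabs x) (CV_radius a).
Proof. intros H; now rewrite (entire_CV_radius a f H). Qed.

Lemma entire_PSeries a f x : entire a f -> PSeries a x = f x.
Proof. intros H; apply is_pseries_unique, H. Qed.

Lemma entire_ext a f g : (forall x, f x = g x) -> entire a f -> entire a g.
Proof. intros E H x; rewrite <- E; apply H. Qed.

(** Identities between coefficient sequences are proved throughout by comparing
    the entire functions that they define. *)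
Lemma entire_unique a b f g :
  entire a f -> entire b g -> (forall x, f x = g x) -> forall n, a n = b n.
Proof.
  intros Ha Hb E n. apply PSeries_ext_recip.
  - now rewrite (entire_CV_radius a f Ha).
  - now rewrite (entire_CV_radius b g Hb).
  - apply filter_forall; intros x.
    now rewrite (entire_PSeries a f x Ha), (entire_PSeries b g x Hb).
Qed.

Lemma entire_mult a b f g :
  entire a f -> entire b g -> entire (PS_mult a b) (fun x => f x * g x).
Proof.
  intros Ha Hb x. apply is_pseries_mult; auto.
  - now apply entire_inside with f.
  - now apply entire_inside with g.
Qed.

Lemma entire_plus a b f g :
  entire a f -> entire b g -> entire (fun n => a n + b n) (fun x => f x + g x).
Proof. intros Ha Hb x. apply (is_pseries_plus (K:=R_AbsRing) (V:=R_NormedModule)); auto. Qed.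

Lemma entire_scal c a f :
  entire a f -> entire (fun n => c * a n) (fun x => c * f x).
Proof.
  intros Ha x. apply (is_pseries_scal (K:=R_AbsRing) (V:=R_NormedModule)).
  - apply Rmult_comm.
  - apply Ha.
Qed.

Lemma entire_incr a f : entire a f -> entire (PS_incr_1 a) (fun x => x * f x).
Proof. intros Ha x. apply (is_pseries_incr_1 (K:=R_AbsRing) (V:=R_NormedModule)), Ha. Qed.

Lemma entire_derive a f g :
  entire a f -> (forall x, is_derive f x (g x)) -> entire (PS_derive a) g.
Proof.
  intros Ha Hg x.
  replace (g x) with (Derive (PSeries a) x).
  - apply is_pseries_derive. now apply entire_inside with f.
  - rewrite (Derive_ext _ f).
    + apply is_derive_unique, Hg.
    + intros t; now apply entire_PSeries.
Qed.

Lemma entire_dilate q a f :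
  entire a f -> entire (fun n => a n * q ^ n) (fun x => f (q * x)).
Proof.
  intros Ha x. apply is_pseries_R.
  apply is_series_ext with (fun n => a n * (q * x) ^ n).
  - intros n; rewrite Rpow_mult_distr. apply eq_sym, Rmult_assoc.
  - now apply entire_is_series.
Qed.

Definition exp_coef (b : R) (n : nat) : R := / INR (fact n) * b ^ n.

Lemma entire_exp b : entire (exp_coef b) (fun x => exp (b * x)).
Proof. apply (entire_dilate b _ exp). intros x; apply is_exp_Reals. Qed.

Definition PS_one (n : nat) : R := match n with O => 1 | S _ => 0 end.

Lemma entire_one : entire PS_one (fun _ => 1).
Proof.
  apply (entire_ext _ (fun x => exp (0 * x))).
  - intros x; now rewrite Rmult_0_l, exp_0.
  - intros x. apply is_pseries_ext with (exp_coef 0); [|apply entire_exp].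
    intros [|n]; unfold exp_coef; simpl; [field | ring].
Qed.

Fixpoint PS_pow (a : nat -> R) (k : nat) : nat -> R :=
  match k with O => PS_one | S k => PS_mult a (PS_pow a k) end.

Lemma entire_pow a f k : entire a f -> entire (PS_pow a k) (fun x => f x ^ k).
Proof.
  intros Ha; induction k as [|k IH]; simpl.
  - apply entire_one.
  - now apply entire_mult.
Qed.

Lemma Series_nonneg (a : nat -> R) : (forall n, 0 <= a n) -> ex_series a -> 0 <= Series a.
Proof.
  intros H E. replace 0 with (Series (fun n => 0 * a n)).
  - apply Series_le; [|exact E]. intros n. rewrite Rmult_0_l. split; [lra | apply H].
  - rewrite Series_scal_l; ring.
Qed.

(** A bound for the l1 norm with weights [r^n].  It is submultiplicative for the
    Cauchy product, which makes it a substitute for Cauchy's estimates. *)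
Definition l1_norm_le (r : R) (a : nat -> R) (M : R) : Prop :=
  ex_series (fun n => Rabs (a n) * r ^ n) /\ Series (fun n => Rabs (a n) * r ^ n) <= M.

Lemma l1_norm_le_mult r a b M N : 0 <= r ->
  l1_norm_le r a M -> l1_norm_le r b N -> l1_norm_le r (PS_mult a b) (M * N).
Proof.
  intros Hr [Ea Ha] [Eb Hb].
  assert (P : forall (a : nat -> R) n, 0 <= Rabs (a n) * r ^ n).
  { intros u n; apply Rmult_le_pos; [apply Rabs_pos | now apply pow_le]. }
  assert (Q : forall (a : nat -> R), ex_series (fun n => Rabs (a n) * r ^ n) ->
     ex_series (fun n => Rabs (Rabs (a n) * r ^ n))).
  { intros u; apply ex_series_ext; intros n. apply eq_sym, Rabs_pos_eq, P. }
  pose proof (is_series_mult _ _ _ _ (Series_correct _ Ea) (Series_correct _ Eb)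
    (Q _ Ea) (Q _ Eb)) as H.
  assert (L : forall n, Rabs (PS_mult a b n) * r ^ n <=
    sum_f_R0 (fun k => Rabs (a k) * r ^ k * (Rabs (b (n - k)%nat) * r ^ (n - k))) n).
  { intros n. unfold PS_mult.
    apply Rle_trans with (sum_f_R0 (fun k => Rabs (a k * b (n - k)%nat)) n * r ^ n).
    - apply Rmult_le_compat_r; [now apply pow_le|]. apply Rsum_abs.
    - rewrite Rmult_comm, scal_sum. apply Req_le, sum_eq. intros k Hk.
      rewrite Rabs_mult. replace (r ^ n) with (r ^ k * r ^ (n - k)); [ring|].
      rewrite <- pow_add; f_equal; lia. }
  assert (E : ex_series (fun n => Rabs (PS_mult a b n) * r ^ n)).
  { eapply ex_series_dominated; [|eexists; exact H]. intros n.
    rewrite Rabs_pos_eq by apply P. apply L. }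
  split; [exact E|].
  apply Rle_trans with (Series (fun n => Rabs (a n) * r ^ n) * Series (fun n => Rabs (b n) * r ^ n)).
  - rewrite <- (is_series_unique _ _ H). apply Series_le; [|eexists; exact H].
    intros n; split; [apply P | apply L].
  - apply Rmult_le_compat; auto.
    + apply Series_nonneg; auto.
    + apply Series_nonneg; auto.
Qed.

Lemma l1_norm_le_one r : l1_norm_le r PS_one 1.
Proof.
  assert (H : is_series (fun n => Rabs (PS_one n) * r ^ n) 1).
  { apply is_series_ext with (fun n => PS_one n * r ^ n).
    - intros [|n]; simpl; [now rewrite Rabs_R1 | now rewrite Rabs_R0].
    - apply (entire_is_series PS_one (fun _ => 1)), entire_one. }
  split; [now exists 1 | rewrite (is_series_unique _ _ H); lra].
Qed.

Lemma l1_norm_le_pow r a M k : 0 <= r -> l1_norm_le r a M -> l1_norm_le r (PS_pow a k) (M ^ k).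
Proof.
  intros Hr Ha; induction k as [|k IH]; simpl.
  - apply l1_norm_le_one.
  - now apply l1_norm_le_mult.
Qed.

Lemma l1_norm_le_exp r b : 0 <= r -> l1_norm_le r (exp_coef b) (exp (Rabs b * r)).
Proof.
  intros Hr.
  assert (H : is_series (fun n => Rabs (exp_coef b n) * r ^ n) (exp (Rabs b * r))).
  { apply is_series_ext with (fun n => exp_coef (Rabs b) n * r ^ n).
    - intros n; unfold exp_coef. rewrite Rabs_mult, RPow_abs, (Rabs_pos_eq (/ _)); [reflexivity|].
      apply Rlt_le, Rinv_0_lt_compat, INR_fact_lt_0.
    - apply (entire_is_series _ (fun r => exp (Rabs b * r))), entire_exp. }
  split; [eexists; exact H | rewrite (is_series_unique _ _ H); lra].
Qed.

(** * Generating functions of the modes *)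

(** Taylor coefficients of [e^{dx}(1-dx)]. *)
Definition damped_coef (d : R) (n : nat) : R :=
  exp_coef d n + - d * PS_incr_1 (exp_coef d) n.

Lemma entire_damped d : entire (damped_coef d) (fun x => exp (d * x) * (1 - d * x)).
Proof.
  apply entire_ext with (fun x => exp (d * x) + - d * (x * exp (d * x))).
  - intros x; ring.
  - apply entire_plus; [apply entire_exp|].
    apply entire_scal, entire_incr, entire_exp.
Qed.

(** In [e^{dx}(1-dx)] the linear term cancels and the coefficient of [x^{n+2}] is at
    most [|d|^{n+2}/n!] in absolute value, so with [s = |d| r] the norm is at most
    [1 + s^2 e^s].  The gain of the factor [s^2] is what survives the power [m-1]
    when [d] is of order [m^{-1/2}]. *)
Lemma l1_norm_le_damped r d : 0 <= r ->
  l1_norm_le r (damped_coef d) (exp ((Rabs d * r) ^ 2 * exp (Rabs d * r))).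
Proof.
  intros Hr. set (s := Rabs d * r).
  assert (Hs : 0 <= s) by (apply Rmult_le_pos; [apply Rabs_pos | exact Hr]).
  (* The three branches are the terms of order 0, 1 and at least 2; the linear
     term cancels. *)
  pose (g := fun n => match n with O => 1 | S O => 0 | S (S n) => s ^ 2 * (exp_coef 1 n * s ^ n) end).
  assert (Hg : is_series g (1 + s ^ 2 * exp s)).
  { apply (is_series_decr_n g 2); [lia|].
    replace (plus _ _) with (s ^ 2 * exp s).
    - apply (is_series_scal_l (s ^ 2) (fun n => exp_coef 1 n * s ^ n) (exp s)).
      apply (entire_is_series _ exp).
      apply entire_ext with (fun x => exp (1 * x)); [|apply entire_exp].
      intros x; now rewrite Rmult_1_l.
    - simpl pred. rewrite sum_Sn, sum_O. unfold plus, opp; simpl. ring. }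
  assert (H : forall n, Rabs (damped_coef d n) * r ^ n <= g n).
  { intros [|[|n]]; unfold damped_coef, exp_coef, g.
    - apply Req_le. simpl. unfold zero; simpl.
      replace (_ + _) with 1 by field. rewrite Rabs_R1; ring.
    - apply Req_le. simpl. replace (_ + _) with 0 by field. rewrite Rabs_R0; ring.
    - unfold PS_incr_1. unfold exp_coef.
      replace (_ + _) with (- ((INR (S n) * / INR (fact (S (S n)))) * d ^ (S (S n)))).
      + rewrite Rabs_Ropp, Rabs_mult, <- RPow_abs.
        assert (F : 0 < / INR (fact n)) by apply Rinv_0_lt_compat, INR_fact_lt_0.
        assert (C : 0 <= INR (S n) * / INR (fact (S (S n))) <= / INR (fact n)).
        { rewrite 2!fact_simpl, !mult_INR.
          pose proof (pos_INR n). pose proof (INR_fact_lt_0 n).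
          rewrite !S_INR in *.
          replace ((INR n + 1) * / ((INR n + 1 + 1) * ((INR n + 1) * INR (fact n))))
            with (/ INR (fact n) * / (INR n + 1 + 1)) by (field; lra).
          assert (0 < / (INR n + 1 + 1) <= 1).
          { split; [apply Rinv_0_lt_compat; lra|].
            rewrite <- Rinv_1. apply Rinv_le_contravar; lra. }
          nra. }
        rewrite (Rabs_pos_eq (_ * / _)) by tauto.
        rewrite pow1.
        replace (s ^ 2 * (/ INR (fact n) * 1 * s ^ n)) with (/ INR (fact n) * s ^ (S (S n)))
          by (simpl; ring).
        unfold s. rewrite Rpow_mult_distr, Rmult_assoc.
        apply Rmult_le_compat_r; [|tauto].
        apply Rmult_le_pos; apply pow_le; [apply Rabs_pos | exact Hr].
      + rewrite (fact_simpl (S n)), mult_INR. pose proof (INR_fact_lt_0 (S n)).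
        rewrite (S_INR (S n)). pose proof (pos_INR (S n)).
        change (d ^ S (S n)) with (d * d ^ S n). field. lra. }
  assert (E : ex_series (fun n => Rabs (damped_coef d n) * r ^ n)).
  { apply ex_series_dominated with g; [|eexists; exact Hg].
    intros n. rewrite Rabs_pos_eq; [apply H|].
    apply Rmult_le_pos; [apply Rabs_pos | now apply pow_le]. }
  split; [exact E|].
  apply Rle_trans with (1 + s ^ 2 * exp s).
  - rewrite <- (is_series_unique _ _ Hg). apply Series_le; [|eexists; exact Hg].
    intros n; split; [|apply H]. apply Rmult_le_pos; [apply Rabs_pos | now apply pow_le].
  - destruct (Req_dec (s ^ 2 * exp s) 0) as [Z|Z].
    + rewrite Z, exp_0; lra.
    + left. now apply exp_ineq1.
Qed.

(** Taylor coefficients of the generating function [mode_gf] of a mode, where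
    [k = m - 1].  Splitting off the factors [e^{dx}] of the power [k] is what
    makes the coefficients bounded uniformly in [k]. *)
Definition mode_coef (rho d : R) (k : nat) : nat -> R :=
  PS_mult (exp_coef (rho + d)) (PS_pow (damped_coef d) k).

Definition mode_gf (rho d : R) (k : nat) (x : R) : R :=
  exp ((rho + d) * x) * (exp (d * x) * (1 - d * x)) ^ k.

Lemma entire_mode_coef rho d k : entire (mode_coef rho d k) (mode_gf rho d k).
Proof.
  apply entire_mult; [apply entire_exp|].
  apply entire_pow, entire_damped.
Qed.

Lemma mode_coef_0 rho d k : mode_coef rho d k 0%nat = 1.
Proof.
  rewrite <- (PSeries_0 (mode_coef rho d k)), (entire_PSeries _ _ 0 (entire_mode_coef rho d k)).
  unfold mode_gf. rewrite !Rmult_0_r, exp_0, Rminus_0_r, Rmult_1_r, pow1. ring.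
Qed.

(** The logarithmic derivative of [mode_gf] is [rho + d - k d^2 x/(1-dx)]; the
    equation is cleared of its denominator. *)
Lemma mode_gf_ode rho d k :
  exists g, (forall x, is_derive (mode_gf rho d k) x (g x)) /\
  forall x, g x + - d * (x * g x) =
    (rho + d) * mode_gf rho d k x
    + - (rho * d + INR (S k) * d ^ 2) * (x * mode_gf rho d k x).
Proof.
  exists (fun x => (rho + d) * mode_gf rho d k x
    + exp ((rho + d) * x) * (INR k * (- d ^ 2 * x * exp (d * x)) *
        (exp (d * x) * (1 - d * x)) ^ pred k)).
  unfold mode_gf. split; intros x.
  - auto_derive; [easy|]. change (1 + - (d * x)) with (1 - d * x). simpl. ring.
  - rewrite S_INR. destruct k as [|k].
    + simpl. ring.
    + simpl pred. simpl pow. ring.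
Qed.

Lemma mode_coef_rec rho d k n :
  INR (n + 1) * mode_coef rho d k (n + 1) - d * (INR n * mode_coef rho d k n) =
  (rho + d) * mode_coef rho d k n
  - (rho * d + INR (S k) * d ^ 2) * PS_incr_1 (mode_coef rho d k) n.
Proof.
  destruct (mode_gf_ode rho d k) as [g [Hg E]].
  pose proof (entire_mode_coef rho d k) as Hp.
  pose proof (entire_derive _ _ _ Hp Hg) as Hd.
  pose proof (entire_unique _ _ _ _
    (entire_plus _ _ _ _ Hd (entire_scal (- d) _ _ (entire_incr _ _ Hd)))
    (entire_plus _ _ _ _ (entire_scal (rho + d) _ _ Hp)
      (entire_scal (- (rho * d + INR (S k) * d ^ 2)) _ _ (entire_incr _ _ Hp))) E n) as H.
  simpl in H. unfold PS_derive in H. rewrite Nat.add_1_r.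
  destruct n as [|n]; simpl PS_incr_1 in *; unfold zero in *; simpl in *; lra.
Qed.

(** The case [rho = 0], [d = -1/m] of the modes: Taylor coefficients of
    [E_m(y) = e^{-y}(1+y/m)^{m-1}], with [m = k + 1]. *)
Definition abel_coef (k : nat) : nat -> R := mode_coef 0 (- / INR (S k)) k.

(** The function [mode_gf rho d k x] is [e^{rho x} E_m(-m d x)], hence a Cauchy
    product in which [d] only occurs through powers of [-m d]. *)
Lemma mode_coef_abel rho d k n :
  mode_coef rho d k n =
  sum_n (fun j => abel_coef k j * (- INR (S k) * d) ^ j * exp_coef rho (n - j)) n.
Proof.
  rewrite sum_n_Reals.
  change (mode_coef rho d k n = PS_mult (fun j => abel_coef k j * (- INR (S k) * d) ^ j) (exp_coef rho) n).
  apply (entire_unique _ _ (mode_gf rho d k)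
   (fun x => mode_gf 0 (- / INR (S k)) k (- INR (S k) * d * x) * exp (rho * x))).
  - apply entire_mode_coef.
  - apply (entire_mult _ _ (fun x => mode_gf 0 (- / INR (S k)) k (- INR (S k) * d * x))).
    + apply (entire_dilate _ _ (mode_gf 0 (- / INR (S k)) k)), entire_mode_coef.
    + apply entire_exp.
  - intros x. unfold mode_gf. assert (INR (S k) <> 0) by now apply not_0_INR.
    replace (- / INR (S k) * (- INR (S k) * d * x)) with (d * x) by now field.
    replace ((0 + - / INR (S k)) * (- INR (S k) * d * x)) with (d * x) by now field.
    rewrite (Rmult_plus_distr_r rho d x), exp_plus. ring.
Qed.

Lemma abel_coef_0 k : abel_coef k 0%nat = 1.
Proof. apply mode_coef_0. Qed.

Lemma abel_coef_rec k n :
  INR (S k) * abel_coef k (n + 1) =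
  - (abel_coef k n + PS_incr_1 (abel_coef k) n / INR (n + 1)).
Proof.
  pose proof (mode_coef_rec 0 (- / INR (S k)) k n) as H. fold (abel_coef k) in H.
  assert (Hk : INR (S k) <> 0) by now apply not_0_INR.
  assert (Hn : INR (n + 1) <> 0) by (apply not_0_INR; lia).
  apply Rmult_eq_reg_l with (INR (n + 1) * / INR (S k)).
  - transitivity (INR (n + 1) * abel_coef k (n + 1)); [now field|].
    replace (_ * abel_coef k (n + 1)) with
     (- / INR (S k) * (INR n * abel_coef k n) + ((0 + - / INR (S k)) * abel_coef k n -
       (0 * - / INR (S k) + INR (S k) * (- / INR (S k)) ^ 2) * PS_incr_1 (abel_coef k) n)) by lra.
    rewrite plus_INR in *. change (INR 1) with 1 in *.
    field. split; assumption.
  - apply Rmult_integral_contrapositive_currified; [exact Hn | now apply Rinv_neq_0_compat].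
Qed.

(** By the recurrence, each step from [a_n] and [a_{n-1}] to [a_{n+1}] gains a
    factor [1/m], so [a_n] is of order [m^{-n/2}]. *)
Lemma abel_coef_bound k n i : (2 * i <= n + 1)%nat ->
  Rabs (abel_coef k n) * INR (S k) ^ i <= 2 ^ n.
Proof.
  assert (Hm : 1 <= INR (S k)) by (rewrite S_INR; pose proof (pos_INR k); lra).
  cut (forall n i, ((2 * i <= n + 1)%nat -> Rabs (abel_coef k n) * INR (S k) ^ i <= 2 ^ n) /\
    ((2 * i <= n + 2)%nat -> Rabs (abel_coef k (n + 1)) * INR (S k) ^ i <= 2 ^ (n + 1))).
  { intros H; apply H. }
  clear n i.
  assert (step : forall n i, (forall i, (2 * i <= n + 1)%nat -> Rabs (abel_coef k n) * INR (S k) ^ i <= 2 ^ n) ->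
    (forall i, (2 * i <= n)%nat -> Rabs (PS_incr_1 (abel_coef k) n) * INR (S k) ^ i <= 2 ^ n) ->
    (2 * i <= n + 2)%nat -> Rabs (abel_coef k (n + 1)) * INR (S k) ^ i <= 2 ^ (n + 1)).
  { intros n i H1 H2 Hi.
    assert (H : forall j, (2 * j <= n)%nat -> Rabs (abel_coef k (n + 1)) * INR (S k) ^ (S j) <= 2 ^ (n + 1)).
    { intros j Hj. simpl pow.
      rewrite <- (Rabs_pos_eq (INR (S k))) at 1 by lra.
      rewrite <- Rmult_assoc, <- Rabs_mult, (Rmult_comm (abel_coef k (n + 1))), abel_coef_rec.
      specialize (H1 j ltac:(lia)). specialize (H2 j Hj).
      rewrite Rabs_Ropp, pow_add, pow_1.
      apply Rle_trans with ((Rabs (abel_coef k n) + Rabs (PS_incr_1 (abel_coef k) n)) * INR (S k) ^ j); [|lra].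
      apply Rmult_le_compat_r; [apply pow_le; lra|].
      apply Rle_trans with (1 := Rabs_triang _ _). apply Rplus_le_compat_l.
      unfold Rdiv. rewrite Rabs_mult.
      rewrite <- Rmult_1_r. apply Rmult_le_compat_l; [apply Rabs_pos|].
      assert (1 <= INR (n + 1)) by (rewrite plus_INR; simpl; pose proof (pos_INR n); lra).
      rewrite Rabs_pos_eq by (apply Rlt_le, Rinv_0_lt_compat; lra).
      rewrite <- Rinv_1. apply Rinv_le_contravar; lra. }
    destruct i as [|i]; [|apply H; lia].
    apply Rle_trans with (2 := H 0%nat ltac:(lia)).
    apply Rmult_le_compat_l; [apply Rabs_pos|]. rewrite pow_1; exact Hm. }
  assert (Z : forall i, (2 * i <= 1)%nat -> Rabs (abel_coef k 0) * INR (S k) ^ i <= 2 ^ 0).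
  { intros i Hi. replace i with 0%nat by lia. rewrite abel_coef_0, Rabs_R1. simpl; lra. }
  induction n as [|n IH]; intros i; split; intros Hi.
  - now apply Z.
  - apply step; auto. intros j Hj. simpl. unfold zero; simpl. rewrite Rabs_R0. lra.
  - replace (S n) with (n + 1)%nat by lia. apply IH; lia.
  - apply step; auto.
    + intros j Hj. replace (S n) with (n + 1)%nat by lia. apply IH; lia.
    + intros j Hj. change (PS_incr_1 (abel_coef k) (S n)) with (abel_coef k n).
      apply Rle_trans with (2 ^ n); [apply IH; lia|].
      simpl. pose proof (pow_le 2 n). lra.
Qed.

Lemma mode_norm rho d k B : Rabs d <= B -> INR (S k) * d ^ 2 <= B ->
  l1_norm_le 2 (mode_coef rho d k) (exp (2 * Rabs (rho + d)) * exp (4 * B * exp (2 * B))).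
Proof.
  intros H1 H2.
  assert (N : l1_norm_le 2 (mode_coef rho d k) (exp (Rabs (rho + d) * 2) *
    exp ((Rabs d * 2) ^ 2 * exp (Rabs d * 2)) ^ k)).
  { apply l1_norm_le_mult; [lra| |].
    - apply l1_norm_le_exp; lra.
    - apply l1_norm_le_pow; [lra | apply l1_norm_le_damped; lra]. }
  destruct N as [E N]. split; [exact E|].
  apply Rle_trans with (1 := N).
  rewrite (Rmult_comm (Rabs _)).
  apply Rmult_le_compat_l; [apply Rlt_le, exp_pos|].
  rewrite <- Rpower_pow by apply exp_pos. unfold Rpower. rewrite ln_exp.
  assert (L : forall u v, u <= v -> exp u <= exp v).
  { intros u v [L| ->]; [left; now apply exp_increasing | apply Rle_refl]. }
  apply L.
  replace (INR k * ((Rabs d * 2) ^ 2 * exp (Rabs d * 2)))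
    with (4 * (INR k * d ^ 2) * exp (Rabs d * 2)).
  - rewrite S_INR in H2. pose proof (pow2_ge_0 d). pose proof (pos_INR k).
    apply Rmult_le_compat; [nra | apply Rlt_le, exp_pos | lra | apply L; lra].
  - rewrite <- (pow2_abs d). ring.
Qed.

(** * Abel's identity and the tree function *)

Lemma exp_coef_plus b c n : PS_mult (exp_coef b) (exp_coef c) n = exp_coef (b + c) n.
Proof.
  apply (entire_unique _ _ (fun x => exp (b * x) * exp (c * x)) (fun x => exp ((b + c) * x))).
  - apply entire_mult; apply entire_exp.
  - apply entire_exp.
  - intros x. now rewrite Rmult_plus_distr_r, exp_plus.
Qed.

(** Up to sign, the [n]-th finite difference of the polynomial [(x+k)^j] in [k],
    with the binomial coefficients divided by [n!]; dividing keeps Pascal's rule out of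
    the induction on [j]. *)
Lemma finite_difference_0 j : forall n x, (j < n)%nat ->
  sum_f_R0 (fun k => (-1) ^ k * (x + INR k) ^ j / (INR (fact k) * INR (fact (n - k)))) n = 0.
Proof.
  induction j as [|j IH]; intros n x Hn.
  - transitivity (PS_mult (exp_coef (-1)) (exp_coef 1) n).
    + unfold PS_mult, exp_coef. apply sum_eq. intros k _. rewrite pow1. simpl pow at 2.
      field. split; apply INR_fact_neq_0.
    + rewrite exp_coef_plus. unfold exp_coef. destruct n; [lia|].
      replace (-1 + 1) with 0 by ring. simpl pow. ring.
  - destruct n as [|n]; [lia|].
    transitivity (x * sum_f_R0 (fun k => (-1) ^ k * (x + INR k) ^ j / (INR (fact k) * INR (fact (S n - k)))) (S n)
      - sum_f_R0 (fun k => (-1) ^ k * (x + 1 + INR k) ^ j / (INR (fact k) * INR (fact (n - k)))) n).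
    + transitivity (sum_f_R0 (fun k => (-1) ^ k * (x + INR k) ^ j / (INR (fact k) * INR (fact (S n - k))) * x) (S n)
       + sum_f_R0 (fun k => INR k * ((-1) ^ k * (x + INR k) ^ j / (INR (fact k) * INR (fact (S n - k))))) (S n)).
      * rewrite <- plus_sum. apply sum_eq. intros k _. simpl pow. field. split; apply INR_fact_neq_0.
      * rewrite <- scal_sum. unfold Rminus. f_equal.
        rewrite decomp_sum by lia. simpl pred. simpl (INR 0). rewrite Rmult_0_l, Rplus_0_l.
        replace (- sum_f_R0 (fun k => (-1) ^ k * (x + 1 + INR k) ^ j / (INR (fact k) * INR (fact (n - k)))) n)
          with (-1 * sum_f_R0 (fun k => (-1) ^ k * (x + 1 + INR k) ^ j / (INR (fact k) * INR (fact (n - k)))) n) by ring.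
        rewrite scal_sum. apply sum_eq. intros k _.
        replace (S n - S k)%nat with (n - k)%nat by lia.
        rewrite fact_simpl, mult_INR. rewrite S_INR.
        replace (x + (INR k + 1)) with (x + 1 + INR k) by ring. simpl pow.
        field. repeat split; try apply INR_fact_neq_0. pose proof (pos_INR k); lra.
    + rewrite !IH by lia. ring.
Qed.

(** Coefficients [m^{m-1}/m!] of the tree function; the constant term is [0], not the
    value [1] of the formula with truncated subtraction. *)
Definition tree_coef (m : nat) : R :=
  match m with O => 0 | S k => INR (S k) ^ k / INR (fact (S k)) end.

Definition self_power_coef (m : nat) : R := INR m ^ m / INR (fact m).

Lemma is_derive_zero_const (f : R -> R) : (forall x, is_derive f x 0) -> forall a b, f a = f b.
Proof.
  intros H a b. destruct (Rtotal_order a b) as [L|[->|L]]; [|reflexivity|].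
  - apply (eq_is_derive f a b); auto.
  - symmetry. apply (eq_is_derive f b a); auto.
Qed.

Lemma is_derive_divided_power c j (y : R) :
  is_derive (fun y : R => (y + c) ^ S j / INR (fact (S j))) y ((y + c) ^ j / INR (fact j)).
Proof.
  assert (H : INR (fact (S j)) = INR (S j) * INR (fact j)) by now rewrite fact_simpl, mult_INR.
  pose proof (INR_fact_neq_0 (S j)) as N. pose proof (INR_fact_neq_0 j) as N'.
  pose proof (not_0_INR (S j) ltac:(easy)) as M.
  set (a := INR (fact (S j))) in *. set (b := INR (fact j)) in *.
  evar_last.
  - apply (is_derive_ext (fun y => / a * (y + c) ^ S j)); [intros t; apply Rmult_comm|].
    apply is_derive_scal, is_derive_pow, (is_derive_plus (K:=R_AbsRing)(V:=R_NormedModule)).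
    + apply is_derive_id.
    + apply (is_derive_const (K:=R_AbsRing)(V:=R_NormedModule)).
  - unfold plus, one, zero; simpl plus; cbn -[INR pow]. rewrite H. as_real.
    field. split; assumption.
Qed.

(** Abel's binomial identity divided by factorials.  Both sides are polynomials in
    [y] whose derivatives agree by the induction hypothesis at [y + 1], and at
    [y = -(m+1)] the left-hand side is a vanishing finite difference. *)
Lemma abel_identity m : forall y,
  sum_f_R0 (fun k => tree_coef k * ((y + INR (S m - k)) ^ (S m - k) / INR (fact (S m - k)))) (S m)
  = (y + INR (S m)) ^ m / INR (fact m).
Proof.
  induction m as [|m IH]; intros y.
  - simpl. field.
  - set (F := fun y => sum_f_R0 (fun k => tree_coef k * ((y + INR (S (S m) - k)) ^ (S (S m) - k) / INR (fact (S (S m) - k)))) (S (S m))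
       - (y + INR (S (S m))) ^ S m / INR (fact (S m))).
    assert (HF : forall y, F y = 0).
    { intros z. transitivity (F (- INR (S (S m)))).
      (* The derivative vanishes by the induction hypothesis, so the argument may be
         moved to the point where the identity is a finite difference. *)
      - apply is_derive_zero_const. clear y z. intros y. change R in (type of y). unfold F.
        replace 0 with (sum_f_R0 (fun k => tree_coef k * ((y + 1 + INR (S m - k)) ^ (S m - k) / INR (fact (S m - k)))) (S m)
          - (y + INR (S (S m))) ^ m / INR (fact m)).
        + apply (is_derive_minus (K:=R_AbsRing)(V:=R_NormedModule)).
          * apply (is_derive_ext (fun y => sum_n (fun k => tree_coef k * ((y + INR (S (S m) - k)) ^ (S (S m) - k) / INR (fact (S (S m) - k)))) (S m)
               + tree_coef (S (S m)))).
            { intros t. rewrite sum_n_Reals, (tech5 _ (S m)), Nat.sub_diag.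
              apply Rplus_eq_compat_l. change (INR (fact 0)) with 1. simpl pow.
              now rewrite Rdiv_1_r, Rmult_1_r. }
            rewrite <- (Rplus_0_r (sum_f_R0 _ _)).
            apply (is_derive_plus (K:=R_AbsRing)(V:=R_NormedModule)); [|apply (is_derive_const (K:=R_AbsRing)(V:=R_NormedModule))].
            rewrite <- sum_n_Reals. 
            apply (is_derive_sum_n (K:=R_AbsRing)(V:=R_NormedModule)). intros k Hk.
            replace (S (S m) - k)%nat with (S (S m - k)) by lia.
            replace (y + 1 + INR (S m - k)) with (y + INR (S (S m - k))) by (rewrite (S_INR (S m - k)); ring).
            apply is_derive_scal, is_derive_divided_power.
          * apply is_derive_divided_power.
        + rewrite IH. replace (y + 1 + INR (S m)) with (y + INR (S (S m))) by (rewrite (S_INR (S m)); ring).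
          ring.
      - unfold F. rewrite Rplus_opp_l. replace (0 ^ S m) with 0 by (simpl; ring).
        unfold Rdiv at 2. rewrite Rmult_0_l, Rminus_0_r.
        transitivity ((-1) ^ S (S m) * sum_f_R0 (fun k => (-1) ^ k * (0 + INR k) ^ S m / (INR (fact k) * INR (fact (S (S m) - k)))) (S (S m))).
        + rewrite scal_sum. apply sum_eq. intros k Hk.
          replace (- INR (S (S m)) + INR (S (S m) - k)) with (-1 * INR k) by (rewrite minus_INR by exact Hk; ring).
          rewrite Rplus_0_l, Rpow_mult_distr.
          replace ((-1) ^ (S (S m) - k)) with ((-1) ^ k * (-1) ^ S (S m)).
          * destruct k as [|k]; [simpl; unfold Rdiv; ring|].
            unfold tree_coef. replace (INR (S k) ^ S m) with (INR (S k) ^ k * INR (S k) ^ (S (S m) - S k)).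
            -- field. split; apply INR_fact_neq_0.
            -- rewrite <- pow_add. f_equal. lia.
          * replace (S (S m)) with (k + (S (S m) - k))%nat at 1 by lia.
            rewrite pow_add, <- Rmult_assoc, <- Rpow_mult_distr.
            replace (-1 * -1) with 1 by ring. rewrite pow1; ring.
        + rewrite finite_difference_0 by lia. ring. }
    specialize (HF y). unfold F in HF. lra.
Qed.

(** Abel's identity at [y = 0].  With [S(z) = sum_n n^n z^n/n!] it says that
    [T S = S - 1]. *)
Lemma tree_conv n : PS_mult tree_coef self_power_coef (S n) = self_power_coef (S n).
Proof.
  pose proof (abel_identity n 0) as H.
  transitivity ((0 + INR (S n)) ^ n / INR (fact n)).
  - rewrite <- H. apply sum_eq. intros k _. unfold self_power_coef. now rewrite Rplus_0_l.
  - unfold self_power_coef. rewrite Rplus_0_l, fact_simpl, mult_INR.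
    change (INR (S n) ^ S n) with (INR (S n) * INR (S n) ^ n).
    field. split; [apply INR_fact_neq_0 | now apply not_0_INR].
Qed.

Definition tree_fun : R -> R := PSeries tree_coef.

(** The number [n^n/n!] is one term of the exponential series of [n]. *)
Lemma self_power_coef_bound n : self_power_coef n * exp (-1) ^ n <= 1.
Proof.
  assert (H : self_power_coef n <= exp (INR n)).
  { apply Rle_trans with (2 := exp_ge_taylor (INR n) n (pos_INR n)).
    destruct n as [|n]; [right; reflexivity|].
    rewrite tech5. unfold self_power_coef.
    assert (0 <= sum_f_R0 (fun k => INR (S n) ^ k / INR (fact k)) n); [|lra].
    apply cond_pos_sum. intros k. apply Rmult_le_pos; [apply pow_le, pos_INR|].
    apply Rlt_le, Rinv_0_lt_compat, INR_fact_lt_0. }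
  replace (exp (-1) ^ n) with (/ exp (INR n)).
  - rewrite <- (Rinv_r (exp (INR n))) by apply Rgt_not_eq, exp_pos.
    apply Rmult_le_compat_r; [|exact H]. apply Rlt_le, Rinv_0_lt_compat, exp_pos.
  - rewrite <- exp_Ropp, <- Rpower_pow by apply exp_pos. unfold Rpower. rewrite ln_exp.
    f_equal; ring.
Qed.

Lemma self_power_coef_pos n : 0 < self_power_coef n.
Proof.
  unfold self_power_coef. apply Rdiv_lt_0_compat; [|apply INR_fact_lt_0].
  destruct n; [simpl; lra|]. apply pow_lt, lt_0_INR; lia.
Qed.

Lemma INR_tree_coef n : (1 <= n)%nat -> INR n * tree_coef n = self_power_coef n.
Proof.
  destruct n as [|n]; [lia|]. intros _. unfold tree_coef, self_power_coef.
  change (INR (S n) ^ S n) with (INR (S n) * INR (S n) ^ n). unfold Rdiv; ring.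
Qed.

Lemma tree_coef_bounds n : 0 <= tree_coef n <= self_power_coef n.
Proof.
  destruct n as [|n].
  - split; [simpl; lra | apply Rlt_le, self_power_coef_pos].
  - rewrite <- INR_tree_coef by lia.
    assert (1 <= INR (S n)) by (rewrite S_INR; pose proof (pos_INR n); lra).
    assert (0 <= tree_coef (S n)).
    { apply Rmult_le_pos; [apply pow_le, pos_INR|].
      apply Rlt_le, Rinv_0_lt_compat, INR_fact_lt_0. }
    nra.
Qed.

Lemma CV_radius_ge_of_bound a r M : (forall n, Rabs (a n) * r ^ n <= M) -> 0 <= r ->
  Rbar_le r (CV_radius a).
Proof.
  intros H Hr. apply (CV_radius_bounded a). exists M. intros n.
  rewrite Rabs_mult, <- RPow_abs, (Rabs_pos_eq r) by exact Hr. apply H.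
Qed.

Lemma disk_inside a z : Rbar_le (exp (-1)) (CV_radius a) -> 0 <= z < exp (-1) ->
  Rbar_lt (Rabs z) (CV_radius a).
Proof.
  intros H Hz. rewrite Rabs_pos_eq by lra.
  apply Rbar_lt_le_trans with (2 := H). simpl; lra.
Qed.

Lemma CV_radius_self_power : Rbar_le (exp (-1)) (CV_radius self_power_coef).
Proof.
  apply CV_radius_ge_of_bound with 1; [|apply Rlt_le, exp_pos]. intros n.
  rewrite Rabs_pos_eq by apply Rlt_le, self_power_coef_pos. apply self_power_coef_bound.
Qed.

Lemma CV_radius_tree : Rbar_le (exp (-1)) (CV_radius tree_coef).
Proof.
  apply CV_radius_ge_of_bound with 1; [|apply Rlt_le, exp_pos]. intros n.
  pose proof (tree_coef_bounds n). rewrite Rabs_pos_eq by tauto.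
  apply Rle_trans with (2 := self_power_coef_bound n).
  apply Rmult_le_compat_r; [apply pow_le, Rlt_le, exp_pos | tauto].
Qed.

Lemma PSeries_nonneg a z : (forall n, 0 <= a n) -> 0 <= z ->
  Rbar_lt (Rabs z) (CV_radius a) -> 0 <= PSeries a z.
Proof.
  intros H Hz Hr. apply Series_nonneg.
  - intros n. apply Rmult_le_pos; [apply H | now apply pow_le].
  - destruct (CV_radius_inside _ _ Hr) as [l Hl]. exists l.
    exact (proj1 (is_pseries_R a z l) Hl).
Qed.

(** Since [S = 1 + z T'], the relation [T S = S - 1] is both the bound [T < 1] and
    the differential equation [z T' (1 - T) = T]. *)
Lemma tree_fun_eq z : 0 <= z < exp (-1) ->
  0 <= tree_fun z < 1 /\ z * PSeries (PS_derive tree_coef) z * (1 - tree_fun z) = tree_fun z.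
Proof.
  intros Hz.
  pose proof (disk_inside _ z CV_radius_tree Hz) as Ht.
  pose proof (disk_inside _ z CV_radius_self_power Hz) as Hs.
  set (S := PSeries self_power_coef z).
  assert (HTS : tree_fun z * S = S - 1).
  { unfold tree_fun, S. rewrite <- PSeries_mult by assumption.
    rewrite (PSeries_decr_1 self_power_coef) by now apply CV_radius_inside.
    rewrite (PSeries_decr_1 (PS_mult _ _)) by now apply ex_pseries_mult.
    rewrite (PSeries_ext (PS_decr_1 (PS_mult tree_coef self_power_coef)) (PS_decr_1 self_power_coef)).
    - unfold PS_mult, self_power_coef; simpl. unfold Rdiv; rewrite Rinv_1; ring.
    - intros n. apply tree_conv. }
  assert (HD : z * PSeries (PS_derive tree_coef) z = S - 1).
  { unfold S. rewrite (PSeries_decr_1 self_power_coef) by now apply CV_radius_inside.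
    rewrite (PSeries_ext (PS_derive tree_coef) (PS_decr_1 self_power_coef)).
    - unfold self_power_coef at 2; simpl. unfold Rdiv; rewrite Rinv_1; ring.
    - intros n. apply INR_tree_coef; lia. }
  assert (HS : 0 < S).
  (* [S <= 0] would make [S - 1 = z T'] negative. *)
  { destruct (Rle_or_lt S 0) as [L|L]; [exfalso|exact L].
    assert (0 <= PSeries (PS_derive tree_coef) z).
    { apply PSeries_nonneg; [|lra|].
      - intros n. unfold PS_derive. apply Rmult_le_pos; [apply pos_INR | apply tree_coef_bounds].
      - now rewrite CV_radius_derive. }
    nra. }
  assert (0 <= tree_fun z) by (apply PSeries_nonneg; [apply tree_coef_bounds | lra | exact Ht]).
  split; [nra | rewrite HD; nra].
Qed.

(** By the differential equation, [T(z) e^{-T(z)}/z] has derivative [0]; it tends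
    to [1] at [0]. *)
Lemma tree_fun_inverse_eq z : 0 <= z < exp (-1) ->
  tree_fun z * exp (- tree_fun z) = z.
Proof.
  intros Hz.
  (* [Q = T/z], extended continuously to [0]. *)
  set (Q := PSeries (PS_decr_1 tree_coef)).
  assert (HQ : forall x, 0 <= x < exp (-1) -> tree_fun x = x * Q x).
  { intros x Hx. unfold tree_fun, Q. rewrite PSeries_decr_1.
    - simpl; ring.
    - apply CV_radius_inside, disk_inside; [apply CV_radius_tree | exact Hx]. }
  assert (HrQ : Rbar_le (exp (-1)) (CV_radius (PS_decr_1 tree_coef))).
  { rewrite CV_radius_decr_1. apply CV_radius_tree. }
  set (K := fun x => Q x * exp (- tree_fun x)).
  assert (DK : forall x, 0 <= x < exp (-1) -> is_derive K x
     (PSeries (PS_derive (PS_decr_1 tree_coef)) x * exp (- tree_fun x)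
      - Q x * (PSeries (PS_derive tree_coef) x * exp (- tree_fun x)))).
  { intros x Hx.
    pose proof (is_derive_PSeries _ _ (disk_inside _ _ HrQ Hx)) as D1.
    pose proof (is_derive_PSeries _ _ (disk_inside _ _ CV_radius_tree Hx)) as D2.
    fold Q in D1. fold tree_fun in D2. unfold K.
    auto_derive.
    - split; [eexists; exact D1 | split; [eexists; exact D2 | easy]].
      change (fun x0 : R => Q x0) with Q. change (fun x0 : R => tree_fun x0) with tree_fun.
      rewrite (is_derive_unique _ _ _ D1), (is_derive_unique _ _ _ D2). ring. }
  assert (K1 : K z = 1).
  { assert (K0 : K 0 = 1).
    { unfold K, Q. rewrite HQ by (pose proof (exp_pos (-1)); lra).
      rewrite Rmult_0_l, Ropp_0, exp_0, PSeries_0. unfold PS_decr_1. simpl. field. }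
    rewrite <- K0.
    destruct (MVT_gen K 0 z (fun _ => 0)) as [c [_ Hc]].
    - rewrite Rmin_left, Rmax_right by lra. intros x Hx.
      evar_last; [apply DK; lra|].
      assert (HT : Derive tree_fun x = Q x + x * PSeries (PS_derive (PS_decr_1 tree_coef)) x).
      { rewrite (Derive_ext_loc tree_fun (fun x => x * Q x)).
        - rewrite Derive_mult, Derive_id.
          + unfold Q. rewrite Derive_PSeries by (apply disk_inside; [exact HrQ | lra]). 
            as_real. ring.
          + apply ex_derive_id.
          + apply ex_derive_PSeries, disk_inside; [exact HrQ | lra].
        - assert (Hd : 0 < Rmin x (exp (-1) - x)) by (apply Rmin_glb_lt; lra).
          exists (mkposreal _ Hd). intros y Hy. apply HQ.
          unfold ball in Hy; simpl in Hy; unfold AbsRing_ball, abs, minus, plus, opp in Hy; simpl in Hy.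
          pose proof (Rmin_l x (exp (-1) - x)). pose proof (Rmin_r x (exp (-1) - x)).
          apply Rabs_def2 in Hy. lra. }
      unfold tree_fun in HT at 1. rewrite Derive_PSeries in HT by (apply disk_inside; [apply CV_radius_tree | lra]).
      destruct (tree_fun_eq x) as [_ E]; [lra|].
      assert (HQx := HQ x ltac:(lra)).
      set (T' := PSeries (PS_derive tree_coef) x) in *.
      set (Q' := PSeries (PS_derive (PS_decr_1 tree_coef)) x) in *.
      (* Multiplied by [x^2], this is the differential equation of [T = x Q]. *)
      assert (E0 : Q' - Q x * T' = 0).
      { apply Rmult_eq_reg_l with (x * x); [|nra].
        replace (x * x * (Q' - Q x * T')) with (x * (x * Q') - x * (x * Q x) * T') by ring.
        rewrite <- HQx. replace (x * Q') with (T' - Q x) by lra.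
        replace (x * (T' - Q x) - x * tree_fun x * T') with (x * T' * (1 - tree_fun x) - x * Q x) by ring.
        rewrite E, HQx. ring. }
      transitivity ((Q' - Q x * T') * exp (- tree_fun x)); [ring|]. rewrite E0. apply Rmult_0_l.
    - rewrite Rmin_left, Rmax_right by lra. intros x Hx.
      apply continuity_pt_filterlim, (ex_derive_continuous K).
      eexists. apply DK; lra.
    - lra. }
  unfold K in K1. rewrite (HQ z Hz) at 1. rewrite Rmult_assoc, K1. ring.
Qed.

Lemma x_exp_neg_x_bounds u : 0 <= u < 1 -> 0 <= u * exp (- u) < exp (-1).
Proof.
  intros Hu. split; [apply Rmult_le_pos; [lra | apply Rlt_le, exp_pos]|].
  pose proof (exp_ineq1 (u - 1) ltac:(lra)) as H.
  replace (exp (-1)) with (exp (u - 1) * exp (- u)) by (rewrite <- exp_plus; f_equal; ring).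
  apply Rmult_lt_compat_r; [apply exp_pos | lra].
Qed.

Lemma x_exp_neg_x_incr a b : 0 <= a -> a < b -> b < 1 -> a * exp (- a) < b * exp (- b).
Proof.
  intros Ha Hab Hb.
  destruct (MVT_gen (fun x => x * exp (- x)) a b (fun x => (1 - x) * exp (- x))) as [c [Hc E]].
  - intros x _. auto_derive; [easy|]. ring.
  - intros x _. apply continuity_pt_filterlim, (ex_derive_continuous (fun x => x * exp (- x))). auto_derive; easy.
  - rewrite Rmin_left, Rmax_right in Hc by lra.
    assert (0 < (1 - c) * exp (- c) * (b - a)); [|lra].
    apply Rmult_lt_0_compat; [|lra]. apply Rmult_lt_0_compat; [lra | apply exp_pos].
Qed.

Lemma tree_fun_x_exp_neg_x u : 0 <= u < 1 -> tree_fun (u * exp (- u)) = u.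
Proof.
  intros Hu. pose proof (x_exp_neg_x_bounds u Hu) as Hz.
  pose proof (tree_fun_inverse_eq _ Hz) as E.
  destruct (tree_fun_eq _ Hz) as [B _].
  set (T := tree_fun (u * exp (- u))) in *.
  destruct (Rtotal_order T u) as [L|[L|L]]; [|exact L|].
  - pose proof (x_exp_neg_x_incr T u). lra.
  - pose proof (x_exp_neg_x_incr u T). lra.
Qed.

(** * Abel moments of the Borel weights *)

Definition u_seq (j : nat) : R := 1 - / (INR j + 1).
Definition z_seq (j : nat) : R := u_seq j * exp (- u_seq j).

Lemma u_seq_bounds j : 0 <= u_seq j < 1.
Proof.
  unfold u_seq. pose proof (pos_INR j).
  assert (0 < / (INR j + 1)) by (apply Rinv_0_lt_compat; lra).
  assert (/ (INR j + 1) <= 1) by (rewrite <- Rinv_1; apply Rinv_le_contravar; lra).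
  lra.
Qed.

Lemma z_seq_bounds j : 0 <= z_seq j < exp (-1).
Proof. apply x_exp_neg_x_bounds, u_seq_bounds. Qed.

Lemma is_lim_inv_succ : is_lim_seq (fun j => / (INR j + 1)) 0.
Proof.
  replace (Finite 0) with (Rbar_inv p_infty) by reflexivity.
  apply is_lim_seq_inv; [|easy].
  apply is_lim_seq_ext with (fun j => INR (S j)); [intros j; apply S_INR|].
  apply (is_lim_seq_incr_1 INR), is_lim_seq_INR.
Qed.

Lemma u_seq_lim : is_lim_seq u_seq 1.
Proof.
  replace 1 with (1 - 0) by ring.
  apply is_lim_seq_minus'; [apply is_lim_seq_const | apply is_lim_inv_succ].
Qed.

Lemma z_seq_lim : is_lim_seq z_seq (exp (-1)).
Proof.
  replace (exp (-1)) with ((fun x => x * exp (- x)) 1) by (rewrite Rmult_1_l; f_equal; ring).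
  apply (is_lim_seq_continuous (fun x => x * exp (- x))); [|apply u_seq_lim].
  apply continuity_pt_filterlim, (ex_derive_continuous (fun x => x * exp (- x))).
  auto_derive; easy.
Qed.

(** The partial sums of [T(z)] for [z = u e^{-u}] are at most [u < 1]; letting [u]
    tend to [1] bounds those at [z = 1/e].  This replaces Stirling's formula. *)
Lemma tree_coef_summable : ex_series (fun m => tree_coef m * exp (-1) ^ m).
Proof.
  assert (P : forall m, 0 <= tree_coef m * exp (-1) ^ m).
  { intros m. apply Rmult_le_pos; [apply tree_coef_bounds | apply pow_le, Rlt_le, exp_pos]. }
  apply ex_finite_lim_seq_incr with 1.
  - intros N. rewrite sum_Sn. unfold plus; simpl plus. specialize (P (S N)). cbn -[tree_coef pow] in *. lra.
  - intros N.
    apply (is_lim_seq_le (fun j => sum_n (fun m => tree_coef m * z_seq j ^ m) N) (fun _ => 1)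
       (sum_n (fun m => tree_coef m * exp (-1) ^ m) N) 1).
    + intros j. pose proof (z_seq_bounds j) as Hz. pose proof (u_seq_bounds j) as Hu.
      assert (E : ex_series (fun m => tree_coef m * z_seq j ^ m)).
      { destruct (CV_radius_inside _ _ (disk_inside _ _ CV_radius_tree Hz)) as [l Hl].
        exists l. exact (proj1 (is_pseries_R _ _ _) Hl). }
      apply Rle_trans with (u_seq j); [|lra].
      rewrite <- (tree_fun_x_exp_neg_x _ Hu). fold (z_seq j).
      unfold tree_fun, PSeries. rewrite (Series_split _ N E).
      assert (0 <= Series (fun k => tree_coef (S N + k) * z_seq j ^ (S N + k))); [|lra].
      apply Series_nonneg.
      * intros k. apply Rmult_le_pos; [apply tree_coef_bounds | apply pow_le; lra].
      * now apply (ex_series_incr_n (fun m => tree_coef m * z_seq j ^ m) (S N)).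
    + apply sum_n_is_lim. intros m.
      apply is_lim_seq_mult'; [apply is_lim_seq_const|].
      apply (is_lim_seq_continuous (fun x => x ^ m)); [|apply z_seq_lim].
      apply derivable_continuous_pt, derivable_pt_pow.
    + apply is_lim_seq_const.
Qed.

(** Coefficients in [z] of the [y^{n-1}]-part of
    [sum_m m^{m-1} E_m(y) z^m/m!].  The shift of [n] by one makes the case
    [n = 0] the zero series, so that the recurrence holds for all [n]. *)
Definition abel_tree_coef (n m : nat) : R :=
  match m with O => 0 | S k => tree_coef m * PS_incr_1 (abel_coef k) n end.

Lemma abel_tree_coef_bound n m : Rabs (abel_tree_coef n m) <= 2 ^ n * tree_coef m.
Proof.
  destruct m as [|k].
  - simpl. rewrite Rabs_R0. lra.
  - change (abel_tree_coef n (S k)) with (tree_coef (S k) * PS_incr_1 (abel_coef k) n).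
    rewrite Rabs_mult, (Rabs_pos_eq (tree_coef _)) by apply (tree_coef_bounds (S k)).
    rewrite Rmult_comm. apply Rmult_le_compat_r; [apply (tree_coef_bounds (S k))|].
    destruct n as [|n]; simpl PS_incr_1.
    + unfold zero; simpl. rewrite Rabs_R0; lra.
    + pose proof (abel_coef_bound k n 0 ltac:(lia)). rewrite pow_O, Rmult_1_r in H.
      simpl. pose proof (pow_le 2 n). lra.
Qed.

Lemma CV_radius_abel_tree n : Rbar_le (exp (-1)) (CV_radius (abel_tree_coef n)).
Proof.
  apply CV_radius_ge_of_bound with (2 ^ n * 1); [|apply Rlt_le, exp_pos]. intros m.
  apply Rle_trans with (2 ^ n * (self_power_coef m * exp (-1) ^ m)).
  - rewrite <- Rmult_assoc. apply Rmult_le_compat_r; [apply pow_le, Rlt_le, exp_pos|].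
    apply Rle_trans with (1 := abel_tree_coef_bound n m).
    apply Rmult_le_compat_l; [apply pow_le; lra | apply tree_coef_bounds].
  - apply Rmult_le_compat_l; [apply pow_le; lra | apply self_power_coef_bound].
Qed.

Lemma abel_tree_coef_rec n m :
  INR m * abel_tree_coef (n + 2) m =
  - (abel_tree_coef (n + 1) m + / INR (n + 1) * abel_tree_coef n m).
Proof.
  destruct m as [|k]; [simpl; ring|].
  replace (n + 2)%nat with (S (n + 1)) by lia. unfold abel_tree_coef.
  replace (PS_incr_1 (abel_coef k) (n + 1)) with (abel_coef k n) by now rewrite Nat.add_1_r.
  pose proof (abel_coef_rec k n) as H. unfold Rdiv in H.
  change (PS_incr_1 (abel_coef k) (S (n + 1))) with (abel_coef k (n + 1)).
  set (t := tree_coef (S k)).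
  replace (INR (S k) * (t * abel_coef k (n + 1))) with (t * (INR (S k) * abel_coef k (n + 1))) by ring.
  rewrite H. ring.
Qed.

(** Induction with step two.  With [z = u e^{-u}] the operator [z d/dz] is
    [u/(1-u) d/du], so [abel_tree_coef_rec] prescribes the [u]-derivative of the
    series for [n + 2] from the two previous ones; both sides vanish at [u = 0]. *)
Lemma abel_tree_fun n : forall u, 0 <= u < 1 ->
  PSeries (abel_tree_coef n) (u * exp (- u)) = ((u - 1) ^ n - (-1) ^ n) / INR (fact n).
Proof.
  cut (forall n,
   (forall u, 0 <= u < 1 -> PSeries (abel_tree_coef n) (u * exp (- u)) = ((u - 1) ^ n - (-1) ^ n) / INR (fact n)) /\
   (forall u, 0 <= u < 1 -> PSeries (abel_tree_coef (n + 1)) (u * exp (- u)) = ((u - 1) ^ (n + 1) - (-1) ^ (n + 1)) / INR (fact (n + 1)))).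
  { intros H; apply H. }
  clear n. induction n as [|n [IH0 IH1]]; split.
  - intros u Hu. rewrite (PSeries_ext _ (fun _ => 0)), PSeries_const_0.
    + simpl. field.
    + intros [|k]; simpl abel_tree_coef; [reflexivity|]. unfold zero; simpl; ring.
  - intros u Hu. rewrite (PSeries_ext _ tree_coef).
    + change (tree_fun (u * exp (- u)) = ((u - 1) ^ 1 - (-1) ^ 1) / INR (fact 1)).
      rewrite tree_fun_x_exp_neg_x by exact Hu. simpl. field.
    + intros [|k]; [reflexivity|].
      change (tree_coef (S k) * abel_coef k 0 = tree_coef (S k)). rewrite abel_coef_0; ring.
  - now replace (S n) with (n + 1)%nat by lia.
  - replace (S n + 1)%nat with (n + 2)%nat by lia.
    set (b := abel_tree_coef (n + 2)).
    (* The difference of the two sides; its derivative is [0] on ]0, 1[. *)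
    set (G := fun u => PSeries b (u * exp (- u)) - ((u - 1) ^ (n + 2) - (-1) ^ (n + 2)) / INR (fact (n + 2))).
    assert (DG : forall u, 0 <= u < 1 -> is_derive G u
      ((1 - u) * exp (- u) * PSeries (PS_derive b) (u * exp (- u)) - (u - 1) ^ (n + 1) / INR (fact (n + 1)))).
    { intros u Hu. pose proof (x_exp_neg_x_bounds u Hu) as Hz.
      apply (is_derive_minus (K:=R_AbsRing)(V:=R_NormedModule)).
      - apply (is_derive_comp (K:=R_AbsRing) (V:=R_NormedModule) (PSeries b) (fun u => u * exp (- u))).
        + apply is_derive_PSeries, disk_inside; [apply CV_radius_abel_tree | exact Hz].
        + auto_derive; [easy|]. ring.
      - replace (n + 2)%nat with (S (n + 1)) by lia.
        apply (is_derive_ext (fun u => (u + - (1)) ^ S (n + 1) / INR (fact (S (n + 1))) + - ((-1) ^ S (n + 1) / INR (fact (S (n + 1)))))).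
        + intros t. as_real. unfold Rminus, Rdiv. ring.
        + rewrite <- (Rplus_0_r ((u - 1) ^ (n + 1) / _)).
          apply (is_derive_plus (K:=R_AbsRing)(V:=R_NormedModule)).
          * apply is_derive_divided_power.
          * apply (is_derive_const (K:=R_AbsRing)(V:=R_NormedModule)). }
    intros u Hu.
    cut (G u = G 0).
    { unfold G. rewrite Rmult_0_l, PSeries_0. unfold b at 2. simpl abel_tree_coef.
      replace (0 - 1) with (-1) by ring. unfold Rdiv. intros H. lra. }
    destruct (MVT_gen G 0 u (fun _ => 0)) as [c [_ Hc]]; [| |lra].
    + rewrite Rmin_left, Rmax_right by lra. intros x Hx.
      evar_last; [apply DG; lra|]. as_real.
      assert (Hx' : 0 <= x < 1) by lra.
      pose proof (x_exp_neg_x_bounds x Hx') as Hz. specialize (IH0 x Hx'). specialize (IH1 x Hx').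
      assert (E : x * exp (- x) * PSeries (PS_derive b) (x * exp (- x)) =
        - (PSeries (abel_tree_coef (n + 1)) (x * exp (- x)) + / INR (n + 1) * PSeries (abel_tree_coef n) (x * exp (- x)))).
      { assert (I : forall j, ex_pseries (abel_tree_coef j) (x * exp (- x))).
        { intros j. apply CV_radius_inside, disk_inside; [apply CV_radius_abel_tree | exact Hz]. }
        rewrite <- PSeries_incr_1, <- PSeries_scal, <- PSeries_plus, <- PSeries_opp.
        - apply PSeries_ext. intros m.
          transitivity (INR m * b m).
          + destruct m; [simpl; unfold zero; simpl; ring | reflexivity].
          + unfold b. apply abel_tree_coef_rec.
        - apply I.
        - apply ex_pseries_scal; [apply Rmult_comm | apply I]. }
      rewrite IH0, IH1 in E.
      replace (n + 1)%nat with (S n) in * by lia.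
      rewrite fact_simpl, mult_INR in *.
      pose proof (INR_fact_neq_0 n) as N1. pose proof (not_0_INR (S n) ltac:(easy)) as N2.
      set (D := PSeries (PS_derive b) (x * exp (- x))) in *.
      apply Rmult_eq_reg_l with x; [|lra].
      replace (x * ((1 - x) * exp (- x) * D - (x - 1) ^ S n / (INR (S n) * INR (fact n))))
        with ((1 - x) * (x * exp (- x) * D) - x * (x - 1) ^ S n / (INR (S n) * INR (fact n)))
        by (unfold Rdiv; ring).
      rewrite E. rewrite <- !tech_pow_Rmult. field. split; assumption.
    + rewrite Rmin_left, Rmax_right by lra. intros x Hx.
      apply continuity_pt_filterlim, (ex_derive_continuous G).
      eexists. apply DG; lra.
Qed.

(** The probabilities [m^{m-1} e^{-m}/m!], [m = k + 1], of the critical Borel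
    distribution. *)
Definition borel_weight (k : nat) : R := tree_coef (S k) * exp (- INR (S k)).

Lemma exp_neg_INR m : exp (- INR m) = exp (-1) ^ m.
Proof.
  rewrite <- Rpower_pow by apply exp_pos. unfold Rpower. rewrite ln_exp. f_equal; ring.
Qed.

Lemma borel_weight_pos k : 0 <= borel_weight k.
Proof. apply Rmult_le_pos; [apply tree_coef_bounds | apply Rlt_le, exp_pos]. Qed.

Lemma borel_weight_summable : ex_series borel_weight.
Proof.
  apply (ex_series_ext (fun k => tree_coef (S k) * exp (-1) ^ S k)).
  - intros k. unfold borel_weight. now rewrite exp_neg_INR.
  - apply (ex_series_incr_1 (fun m => tree_coef m * exp (-1) ^ m)), tree_coef_summable.
Qed.

(** Limit [u -> 1] of [abel_tree_fun]. *)
Lemma borel_abel_sum n :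
  is_series (fun k => borel_weight k * abel_coef k n) ((-1) ^ n / INR (fact (n + 1))).
Proof.
  set (b := abel_tree_coef (n + 1)).
  assert (Hb : forall m, Rabs (b m * exp (-1) ^ m) <= 2 ^ (n + 1) * (tree_coef m * exp (-1) ^ m)).
  { intros m. rewrite Rabs_mult, (Rabs_pos_eq (exp (-1) ^ m)) by apply pow_le, Rlt_le, exp_pos.
    rewrite <- Rmult_assoc. apply Rmult_le_compat_r; [apply pow_le, Rlt_le, exp_pos|].
    apply abel_tree_coef_bound. }
  assert (Eg : ex_series (fun m => 2 ^ (n + 1) * (tree_coef m * exp (-1) ^ m))).
  { apply (ex_series_scal_l (2 ^ (n + 1)) (fun m => tree_coef m * exp (-1) ^ m)), tree_coef_summable. }
  assert (Eb : ex_series (fun m => b m * exp (-1) ^ m)) by exact (ex_series_dominated _ _ Hb Eg).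
  assert (L : is_lim_seq (fun j => Series (fun m => b m * z_seq j ^ m)) (Series (fun m => b m * exp (-1) ^ m))).
  { apply is_lim_seq_Series_dominated with (1 := Eg).
    - intros j m. pose proof (z_seq_bounds j) as Hz.
      rewrite Rabs_mult, (Rabs_pos_eq (z_seq j ^ m)) by (apply pow_le; lra).
      rewrite <- Rmult_assoc. apply Rmult_le_compat; try apply abel_tree_coef_bound; try apply Rabs_pos.
      + apply pow_le; lra.
      + apply pow_incr; lra.
    - intros m. apply is_lim_seq_mult'; [apply is_lim_seq_const|].
      apply (is_lim_seq_continuous (fun x => x ^ m)); [|apply z_seq_lim].
      apply derivable_continuous_pt, derivable_pt_pow. }
  assert (L' : is_lim_seq (fun j => Series (fun m => b m * z_seq j ^ m)) ((-1) ^ n / INR (fact (n + 1)))).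
  { apply (is_lim_seq_ext (fun j => ((u_seq j - 1) ^ (n + 1) - (-1) ^ (n + 1)) / INR (fact (n + 1)))).
    - intros j. symmetry. apply (abel_tree_fun (n + 1) (u_seq j)), u_seq_bounds.
    - replace ((-1) ^ n / INR (fact (n + 1))) with
        ((fun u => ((u - 1) ^ (n + 1) - (-1) ^ (n + 1)) / INR (fact (n + 1))) 1).
      + apply (is_lim_seq_continuous (fun u => ((u - 1) ^ (n + 1) - (-1) ^ (n + 1)) / INR (fact (n + 1)))); [|apply u_seq_lim].
        apply continuity_pt_filterlim.
        apply (ex_derive_continuous (fun u => ((u - 1) ^ (n + 1) - (-1) ^ (n + 1)) / INR (fact (n + 1)))).
        generalize (INR (fact (n + 1))) (INR_fact_neq_0 (n + 1)). intros c Hc.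
        auto_derive; easy.
      + cbv beta. replace (1 - 1) with 0 by ring. rewrite Nat.add_1_r.
        rewrite <- !tech_pow_Rmult. unfold Rdiv; ring. }
  apply is_lim_seq_unique in L. apply is_lim_seq_unique in L'. rewrite L in L'.
  injection L' as L'. rewrite <- L'.
  apply (is_series_ext (fun k => b (S k) * exp (-1) ^ S k)).
  - intros k. unfold b, borel_weight. rewrite exp_neg_INR, Nat.add_1_r. 
    change (abel_tree_coef (S n) (S k)) with (tree_coef (S k) * abel_coef k n).
    as_real. ring.
  - apply (is_series_incr_1 (fun m => b m * exp (-1) ^ m)).
    replace (plus _ _) with (Series (fun m => b m * exp (-1) ^ m)); [now apply Series_correct|].
    unfold plus, b; simpl. ring.
Qed.

(** The recurrence of [abel_coef] trades one factor [m] for a lower index [n].  From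
    exponent [0] to exponent [1] the two contributions cancel; afterwards they are
    both [0]. *)
Lemma borel_abel_moment_0 i : forall n, (2 * S i <= n)%nat ->
  is_series (fun k => borel_weight k * (INR (S k) ^ (S i) * abel_coef k n)) 0.
Proof.
  assert (R1 : forall i n x y, is_series (fun k => borel_weight k * (INR (S k) ^ i * abel_coef k (n + 1))) x ->
    is_series (fun k => borel_weight k * (INR (S k) ^ i * abel_coef k n)) y ->
    is_series (fun k => borel_weight k * (INR (S k) ^ (S i) * abel_coef k (n + 2))) (- (x + / INR (n + 2) * y))).
  { clear. intros i n x y Hx Hy.
    apply (is_series_ext (fun k => - (borel_weight k * (INR (S k) ^ i * abel_coef k (n + 1)) +
       / INR (n + 2) * (borel_weight k * (INR (S k) ^ i * abel_coef k n))))).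
    - intros k. pose proof (abel_coef_rec k (n + 1)) as H.
      replace (n + 1 + 1)%nat with (n + 2)%nat in H by lia.
      replace (PS_incr_1 (abel_coef k) (n + 1)) with (abel_coef k n) in H by now rewrite Nat.add_1_r.
      as_real.
      rewrite <- tech_pow_Rmult.
      replace (borel_weight k * (INR (S k) * INR (S k) ^ i * abel_coef k (n + 2)))
        with (borel_weight k * INR (S k) ^ i * (INR (S k) * abel_coef k (n + 2))) by ring.
      rewrite H. unfold Rdiv; ring.
    - apply (is_series_opp (K:=R_AbsRing)(V:=R_NormedModule)), (is_series_plus (K:=R_AbsRing)(V:=R_NormedModule)); [exact Hx|].
      exact (is_series_scal_l (/ INR (n + 2)) _ _ Hy). }
  induction i as [|i IH]; intros n Hn.
  - assert (H0 : forall n, is_series (fun k => borel_weight k * (INR (S k) ^ 0 * abel_coef k n)) ((-1) ^ n / INR (fact (n + 1)))).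
    { intros j. apply (is_series_ext (fun k => borel_weight k * abel_coef k j)); [|apply borel_abel_sum].
      intros k. now rewrite pow_O, Rmult_1_l. }
    destruct n as [|[|n]]; [lia|lia|].
    + replace 0 with (- ((-1) ^ (n + 1) / INR (fact (n + 1 + 1)) + / INR (n + 2) * ((-1) ^ n / INR (fact (n + 1))))).
      * replace (S (S n)) with (n + 2)%nat by lia. apply R1; apply H0.
      * replace (n + 1 + 1)%nat with (S (n + 1)) by lia. rewrite fact_simpl, mult_INR.
        replace (S (n + 1)) with (n + 2)%nat by lia. rewrite (Nat.add_1_r n) at 1.
        rewrite <- tech_pow_Rmult. field. split; [apply INR_fact_neq_0 | apply not_0_INR; lia].
  - replace n with (n - 2 + 2)%nat by lia.
    replace 0 with (- (0 + / INR (n - 2 + 2) * 0)) by ring. apply R1; apply IH; lia.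
Qed.

(** * Expansion in eigenvectors *)

Definition sqrt_disc (rho : R) (k : nat) : R := sqrt (rho ^ 2 + 4 * INR (S k) * rho).
Definition root_plus (rho : R) (k : nat) : R := (- rho + sqrt_disc rho k) / (2 * INR (S k)).
Definition root_minus (rho : R) (k : nat) : R := (- rho - sqrt_disc rho k) / (2 * INR (S k)).

Lemma INR_S_ge_1 k : 1 <= INR (S k).
Proof. rewrite S_INR. pose proof (pos_INR k). lra. Qed.

Lemma sqrt_disc_spec rho k : 0 < rho -> rho < sqrt_disc rho k /\ sqrt_disc rho k * sqrt_disc rho k = rho ^ 2 + 4 * INR (S k) * rho.
Proof.
  intros H. pose proof (INR_S_ge_1 k).
  assert (E : sqrt_disc rho k * sqrt_disc rho k = rho ^ 2 + 4 * INR (S k) * rho) by (apply sqrt_sqrt; nra).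
  split; [|exact E]. pose proof (sqrt_pos (rho ^ 2 + 4 * INR (S k) * rho)). fold (sqrt_disc rho k) in *. nra.
Qed.

Lemma root_plus_add_minus rho k : root_plus rho k + root_minus rho k = - rho / INR (S k).
Proof. pose proof (INR_S_ge_1 k). unfold root_plus, root_minus. field. lra. Qed.

Lemma root_plus_mul_minus rho k : 0 < rho -> root_plus rho k * root_minus rho k = - rho / INR (S k).
Proof.
  intros H. destruct (sqrt_disc_spec rho k H) as [_ E]. pose proof (INR_S_ge_1 k).
  unfold root_plus, root_minus.
  replace ((- rho + sqrt_disc rho k) / (2 * INR (S k)) * ((- rho - sqrt_disc rho k) / (2 * INR (S k))))
    with ((rho ^ 2 - sqrt_disc rho k * sqrt_disc rho k) / (4 * INR (S k) ^ 2)) by (field; lra).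
  rewrite E. field. lra.
Qed.

(** The roots [d = 1 + nu] of the characteristic equation, with [m = k + 1]. *)
Definition char_root (rho : R) (k : nat) (d : R) : Prop :=
  INR (S k) * d ^ 2 + rho * d = rho /\ d <> 0 /\ d < 1.

Lemma root_plus_char rho k : 0 < rho -> char_root rho k (root_plus rho k).
Proof.
  intros H. destruct (sqrt_disc_spec rho k H) as [L E]. pose proof (INR_S_ge_1 k) as Hm.
  assert (D : 0 < root_plus rho k) by (apply Rdiv_lt_0_compat; lra).
  assert (Q : INR (S k) * root_plus rho k ^ 2 + rho * root_plus rho k = rho).
  { unfold root_plus. transitivity ((sqrt_disc rho k * sqrt_disc rho k - rho ^ 2) / (4 * INR (S k))); [field; lra|].
    rewrite E. field. lra. }
  split; [exact Q|]. split; [lra|]. nra.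
Qed.

Lemma root_minus_char rho k : 0 < rho -> char_root rho k (root_minus rho k).
Proof.
  intros H. destruct (sqrt_disc_spec rho k H) as [L E]. pose proof (INR_S_ge_1 k) as Hm.
  assert (D : root_minus rho k < 0).
  { unfold root_minus. apply Rmult_neg_pos; [lra|]. apply Rinv_0_lt_compat; lra. }
  assert (Q : INR (S k) * root_minus rho k ^ 2 + rho * root_minus rho k = rho).
  { unfold root_minus. transitivity ((sqrt_disc rho k * sqrt_disc rho k - rho ^ 2) / (4 * INR (S k))); [field; lra|].
    rewrite E. field. lra. }
  split; [exact Q|]. split; lra.
Qed.

Definition root_bound (rho : R) : R := (rho + 2) ^ 2.

Lemma char_root_bound rho k d : 0 < rho -> char_root rho k d ->
  Rabs d <= root_bound rho /\ INR (S k) * d ^ 2 <= root_bound rho.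
Proof.
  intros H [Q [_ L]]. pose proof (INR_S_ge_1 k) as Hm.
  assert (A : - d <= rho + 1).
  { destruct (Rle_or_lt (- d) (rho + 1)) as [A|A]; [exact A|exfalso].
    pose proof (pow2_ge_0 d). nra. }
  unfold root_bound. split; [apply Rabs_le; split|]; nra.
Qed.

(** The factor [nu/(nu-1)] of [C_coef], in terms of [d = 1 + nu]. *)
Definition mode_weight (d : R) : R := (1 - d) / (2 - d).

Lemma mode_weight_bound d : d < 1 -> Rabs (mode_weight d) <= 1.
Proof.
  intros H. unfold mode_weight. rewrite Rabs_pos_eq.
  - apply Rle_div_l; lra.
  - apply Rdiv_le_0_compat; lra.
Qed.

(** The polynomials [L_j] in [m = k + 1]. *)
Definition root_sum (rho : R) (k j : nat) : R :=
  mode_weight (root_plus rho k) * (- INR (S k) * root_plus rho k) ^ j +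
  mode_weight (root_minus rho k) * (- INR (S k) * root_minus rho k) ^ j.

(** The two roots have the same sum and product, which makes the numerator and the
    denominator of the sum of the two fractions equal. *)
Lemma root_sum_0 rho k : 0 < rho -> root_sum rho k 0 = 1.
Proof.
  intros H. unfold root_sum, mode_weight. rewrite !pow_O, !Rmult_1_r.
  pose proof (root_plus_add_minus rho k) as S1. pose proof (root_plus_mul_minus rho k H) as P.
  destruct (root_plus_char rho k H) as [_ [_ L1]]. destruct (root_minus_char rho k H) as [_ [_ L2]].
  set (x := root_plus rho k) in *. set (y := root_minus rho k) in *.
  apply Rmult_eq_reg_r with ((2 - x) * (2 - y)); [|nra].
  transitivity ((1 - x) * (2 - y) + (1 - y) * (2 - x)); [field; lra|].
  assert (x + y = x * y) by congruence. nra.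
Qed.

Lemma root_sum_1 rho k : 0 < rho -> root_sum rho k 1 = rho.
Proof.
  intros H. unfold root_sum, mode_weight. rewrite !pow_1.
  pose proof (root_plus_add_minus rho k) as S1. pose proof (root_plus_mul_minus rho k H) as P.
  destruct (root_plus_char rho k H) as [_ [_ L1]]. destruct (root_minus_char rho k H) as [_ [_ L2]].
  pose proof (INR_S_ge_1 k) as Hm.
  set (x := root_plus rho k) in *. set (y := root_minus rho k) in *.
  assert (E : x + y = x * y) by congruence.
  assert (R : rho = - INR (S k) * (x * y)) by (rewrite P; field; lra).
  rewrite R at 1.
  apply Rmult_eq_reg_r with ((2 - x) * (2 - y)); [|nra].
  transitivity (- INR (S k) * (x * (1 - x) * (2 - y) + y * (1 - y) * (2 - x))); [field; lra|].
  transitivity (- INR (S k) * (2 * (x + y) - 2 * (x + y) ^ 2 + 2 * (x * y) + (x * y) * (x + y))); [ring|].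
  transitivity (- INR (S k) * (x * y) * (4 - 2 * (x + y) + x * y)); [|ring].
  rewrite E. ring.
Qed.

Lemma root_sum_rec rho k j : 0 < rho ->
  root_sum rho k (S (S j)) = rho * root_sum rho k (S j) + rho * INR (S k) * root_sum rho k j.
Proof.
  intros H. unfold root_sum.
  destruct (root_plus_char rho k H) as [Q1 _]. destruct (root_minus_char rho k H) as [Q2 _].
  assert (A : forall d, INR (S k) * d ^ 2 + rho * d = rho ->
    (- INR (S k) * d) ^ S (S j) = rho * (- INR (S k) * d) ^ S j + rho * INR (S k) * (- INR (S k) * d) ^ j).
  { intros d Q. rewrite <- !tech_pow_Rmult.
    transitivity (INR (S k) * (INR (S k) * d ^ 2) * (- INR (S k) * d) ^ j); [ring|].
    replace (INR (S k) * d ^ 2) with (rho - rho * d) by lra. ring. }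
  rewrite (A _ Q1), (A _ Q2). ring.
Qed.

Definition abel_moment_value (i n : nat) : R :=
  match i with O => (-1) ^ n / INR (fact (n + 1)) | S _ => 0 end.

Lemma borel_abel_moment i n : (2 * i <= n)%nat ->
  is_series (fun k => borel_weight k * (INR (S k) ^ i * abel_coef k n)) (abel_moment_value i n).
Proof.
  intros H. destruct i as [|i]; [|now apply borel_abel_moment_0].
  apply (is_series_ext (fun k => borel_weight k * abel_coef k n)); [|apply borel_abel_sum].
  intros k. now rewrite pow_O, Rmult_1_l.
Qed.

(** Induction on [j] along the recurrence of [root_sum]: its second term raises the
    exponent [i] by one and lowers [j] by two, which preserves [2i + j <= n], and
    contributes [0]. *)
Lemma borel_abel_root_sum rho j : 0 < rho -> forall i n, (2 * i + j <= n)%nat ->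
  is_series (fun k => borel_weight k * (INR (S k) ^ i * abel_coef k n) * root_sum rho k j) (rho ^ j * abel_moment_value i n).
Proof.
  intros H.
  cut (forall j, (forall i n, (2 * i + j <= n)%nat ->
    is_series (fun k => borel_weight k * (INR (S k) ^ i * abel_coef k n) * root_sum rho k j) (rho ^ j * abel_moment_value i n)) /\
   (forall i n, (2 * i + S j <= n)%nat ->
    is_series (fun k => borel_weight k * (INR (S k) ^ i * abel_coef k n) * root_sum rho k (S j)) (rho ^ (S j) * abel_moment_value i n))).
  { intros A i n. apply A. }
  clear j. induction j as [|j [IH0 IH1]]; split; intros i n Hn.
  - apply (is_series_ext (fun k => borel_weight k * (INR (S k) ^ i * abel_coef k n))).
    + intros k. now rewrite root_sum_0, Rmult_1_r.
    + rewrite pow_O, Rmult_1_l. apply borel_abel_moment; lia.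
  - apply (is_series_ext (fun k => rho * (borel_weight k * (INR (S k) ^ i * abel_coef k n)))).
    + intros k. rewrite root_sum_1 by exact H. apply Rmult_comm.
    + rewrite pow_1. refine (is_series_scal_l rho _ _ (borel_abel_moment i n _)). lia.
  - now apply IH1.
  - apply (is_series_ext (fun k => rho * (borel_weight k * (INR (S k) ^ i * abel_coef k n) * root_sum rho k (S j))
       + rho * (borel_weight k * (INR (S k) ^ S i * abel_coef k n) * root_sum rho k j))).
    + intros k. rewrite root_sum_rec by exact H. rewrite <- (tech_pow_Rmult _ i).
      as_real. ring.
    + replace (rho ^ S (S j) * abel_moment_value i n) with (rho * (rho ^ S j * abel_moment_value i n) + rho * (rho ^ j * abel_moment_value (S i) n)).
      * apply (is_series_plus (K:=R_AbsRing)(V:=R_NormedModule)).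
        -- refine (is_series_scal_l rho _ _ (IH1 i n _)). lia.
        -- refine (is_series_scal_l rho _ _ (IH0 (S i) n _)). lia.
      * unfold abel_moment_value at 2. rewrite <- !tech_pow_Rmult. ring.
Qed.

(** Completeness of the modes as far as it is needed.  After
    [borel_abel_root_sum] the sum over [k] has become the Cauchy product of
    [e^x] and [(1-e^{-x})/x], whose value is [(e^x-1)/x]. *)
Lemma eigen_expansion rho n : 0 < rho ->
  is_series (fun k => borel_weight k * (mode_weight (root_plus rho k) * mode_coef rho (root_plus rho k) k n +
                               mode_weight (root_minus rho k) * mode_coef rho (root_minus rho k) k n))
   (rho ^ n / INR (fact (n + 1))).
Proof.
  intros H.
  apply (is_series_ext (fun k => sum_n (fun j => exp_coef rho (n - j) *
     (borel_weight k * (INR (S k) ^ 0 * abel_coef k j) * root_sum rho k j)) n)).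
  { intros k. rewrite !mode_coef_abel, !sum_n_Reals.
    as_real.
    rewrite Rmult_plus_distr_l, <- !Rmult_assoc, !scal_sum, <- plus_sum.
    apply sum_eq. intros j _. unfold root_sum. rewrite pow_O. ring. }
  replace (rho ^ n / INR (fact (n + 1))) with (sum_n (fun j => exp_coef rho (n - j) * (rho ^ j * abel_moment_value 0 j)) n).
  { apply is_series_sum_n. intros j Hj.
    refine (is_series_scal_l _ _ _ (borel_abel_root_sum rho j H 0 j _)). lia. }
  rewrite sum_n_Reals. rewrite Nat.add_1_r.
  as_real.
  pose proof (exp_coef_plus (-1) 1 (S n)) as E.
  replace (-1 + 1) with 0 in E by ring.
  unfold PS_mult in E. rewrite decomp_sum in E by lia. simpl pred in E.
  unfold exp_coef in E. rewrite (pow_ne_zero (S n)) in E by easy.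
  rewrite pow_O, pow1, Nat.sub_0_r in E.
  transitivity (sum_f_R0 (fun i => / INR (fact (S i)) * (-1) ^ S i * (/ INR (fact (S n - S i)) * 1 ^ (S n - S i)) * (- rho ^ n)) n).
  - apply sum_eq. intros j Hj. unfold exp_coef, abel_moment_value. rewrite pow1, Nat.add_1_r.
    replace (rho ^ n) with (rho ^ j * rho ^ (n - j)) by (rewrite <- pow_add; f_equal; lia).
    simpl Nat.sub. rewrite <- (tech_pow_Rmult (-1)). unfold Rdiv. ring.
  - rewrite <- scal_sum.
    match goal with |- _ * ?X = _ => replace X with (- / INR (fact (S n))) end.
    + unfold Rdiv; ring.
    + change (INR (fact 0)) with 1 in E. rewrite Rinv_1 in E. lra.
Qed.

Lemma nu_plus_root rho k : nu_plus rho (k + 1) = root_plus rho k - 1.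
Proof.
  unfold nu_plus, root_plus, sqrt_disc. rewrite Nat.add_1_r. pose proof (INR_S_ge_1 k). field. lra.
Qed.

Lemma nu_minus_root rho k : nu_minus rho (k + 1) = root_minus rho k - 1.
Proof.
  unfold nu_minus, root_minus, sqrt_disc. rewrite Nat.add_1_r. pose proof (INR_S_ge_1 k). field. lra.
Qed.

(** The characteristic equation turns [rho/d] into [rho + m d], which exhibits
    [e^rho Phi_m(nu)] as the value of [mode_gf] at [1]. *)
Lemma spectral_term_eq rho nu t k d : char_root rho k d -> nu (k + 1)%nat = d - 1 ->
  spectral_term rho nu t (k + 1) =
  exp (- rho) * (borel_weight k * (mode_weight d * (exp ((d - 1) * t) * mode_gf rho d k 1))).
Proof.
  intros [Q [Hd L]] E. unfold spectral_term. rewrite E.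
  unfold C_coef, Phi. replace (k + 1 - 1)%nat with k by lia. rewrite Nat.add_1_r.
  replace (d - 1 + 1) with d by ring. replace (- (d - 1)) with (1 - d) by ring.
  replace (rho / d) with (rho + d + INR k * d).
  - unfold mode_gf, borel_weight, mode_weight. rewrite !Rmult_1_r, Rpow_mult_distr.
    rewrite (exp_plus (rho + d)).
    replace (exp (INR k * d)) with (exp d ^ k).
    + change (tree_coef (S k)) with (INR (S k) ^ k / INR (fact (S k))).
      replace ((d - 1) / (d - 1 - 1)) with ((1 - d) / (2 - d)) by (field; lra).
      ring.
    + rewrite <- Rpower_pow by apply exp_pos. unfold Rpower. now rewrite ln_exp.
  - rewrite S_INR in Q. apply Rmult_eq_reg_r with d; [|exact Hd].
    unfold Rdiv. rewrite Rmult_assoc, Rinv_l by exact Hd. lra.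
Qed.

Definition mode_norm_bound (rho : R) : R :=
  exp (2 * (rho + root_bound rho)) * exp (4 * root_bound rho * exp (2 * root_bound rho)).

Lemma mode_norm_le rho k d : 0 < rho -> char_root rho k d ->
  l1_norm_le 2 (mode_coef rho d k) (mode_norm_bound rho).
Proof.
  intros H R. destruct (char_root_bound rho k d H R) as [B1 B2].
  destruct (mode_norm rho d k _ B1 B2) as [E N]. split; [exact E|].
  apply Rle_trans with (1 := N). apply Rmult_le_compat_r; [apply Rlt_le, exp_pos|].
  assert (X : 2 * Rabs (rho + d) <= 2 * (rho + root_bound rho)).
  { pose proof (Rabs_triang rho d). rewrite (Rabs_pos_eq rho) in *; lra. }
  destruct X as [X|X]; [left; now apply exp_increasing | rewrite X; apply Rle_refl].
Qed.

(** * The backward equations *)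

Lemma is_derive_nonneg_eps f t l : is_derive_nonneg f t l ->
  forall eps : posreal, exists delta : posreal, forall s, 0 <= s -> Rabs (s - t) < delta ->
  Rabs (f s - f t - (s - t) * l) <= eps * Rabs (s - t).
Proof.
  intros [_ H] eps.
  assert (Hl : is_filter_lim (within (fun s => 0 <= s) (locally t)) t).
  { intros P HP. unfold within. apply filter_imp with (2 := HP). auto. }
  destruct (H t Hl eps) as [delta Hd]. exists delta. intros s Hs Hst.
  exact (Hd s Hst Hs).
Qed.

Lemma is_derive_nonneg_unique f t l l' : 0 <= t ->
  is_derive_nonneg f t l -> is_derive_nonneg f t l' -> l = l'.
Proof.
  intros Ht H H'. apply Rminus_diag_uniq.
  destruct (Req_dec (l - l') 0) as [E|N]; [exact E|exfalso].
  assert (He : 0 < Rabs (l - l') / 4) by (pose proof (Rabs_pos_lt _ N); lra).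
  destruct (is_derive_nonneg_eps f t l H (mkposreal _ He)) as [d1 H1].
  destruct (is_derive_nonneg_eps f t l' H' (mkposreal _ He)) as [d2 H2].
  (* A step to the right, which stays in the domain even at [t = 0]. *)
  set (h := Rmin d1 d2 / 2).
  assert (Hh : 0 < h /\ h < d1 /\ h < d2).
  { unfold h. pose proof (Rmin_l d1 d2). pose proof (Rmin_r d1 d2).
    assert (0 < Rmin d1 d2) by (apply Rmin_glb_lt; apply cond_pos). lra. }
  specialize (H1 (t + h)). specialize (H2 (t + h)).
  replace (t + h - t) with h in * by ring.
  rewrite (Rabs_pos_eq h) in * by lra.
  specialize (H1 ltac:(lra) ltac:(lra)). specialize (H2 ltac:(lra) ltac:(lra)).
  simpl in H1, H2.
  assert (T : Rabs (h * (l - l')) <= Rabs (l - l') / 4 * h + Rabs (l - l') / 4 * h).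
  { replace (h * (l - l')) with ((f (t + h) - f t - h * l') + - (f (t + h) - f t - h * l)) by ring.
    apply Rle_trans with (1 := Rabs_triang _ _). rewrite Rabs_Ropp. lra. }
  rewrite Rabs_mult, (Rabs_pos_eq h) in T by lra. nra.
Qed.

Lemma is_derive_nonneg_interior f t l : 0 < t ->
  is_derive_nonneg f t l -> is_derive f t l.
Proof.
  intros Ht H. split; [apply H|].
  intros x Hx eps.
  apply (is_filter_lim_locally_unique (K := R_AbsRing) (V := R_NormedModule)) in Hx. subst x.
  destruct (is_derive_nonneg_eps f t l H eps) as [delta Hd].
  assert (Hm : 0 < Rmin delta t) by (apply Rmin_glb_lt; [apply cond_pos | exact Ht]).
  exists (mkposreal _ Hm). intros s Hs.
  change (Rabs (s - t) < Rmin delta t) in Hs.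
  pose proof (Rmin_l delta t). pose proof (Rmin_r delta t).
  apply Hd; [|lra]. apply Rabs_def2 in Hs. lra.
Qed.

(** Composing with [Rmax 0] extends a function on [0, +oo) to the line, so that the
    usual mean value theorem applies up to the boundary point [0]. *)
Lemma is_derive_nonneg_continuity f t l : 0 <= t ->
  is_derive_nonneg f t l -> continuity_pt (fun s => f (Rmax 0 s)) t.
Proof.
  intros Ht H eps Heps.
  destruct (is_derive_nonneg_eps f t l H (mkposreal 1 Rlt_0_1)) as [delta Hd].
  assert (Hl : 0 < 1 + Rabs l) by (pose proof (Rabs_pos l); lra).
  exists (Rmin delta (eps / (1 + Rabs l))). split.
  { apply Rmin_glb_lt; [apply cond_pos | now apply Rdiv_lt_0_compat]. }
  intros s [_ Hs]. simpl in *. unfold Rdist in *.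
  rewrite (Rmax_right 0 t) by exact Ht.
  assert (A : Rabs (Rmax 0 s - t) <= Rabs (s - t)).
  { unfold Rmax. destruct (Rle_dec 0 s); [apply Rle_refl|].
    rewrite (Rabs_left1 (s - t)), (Rabs_left1 (0 - t)) by lra. lra. }
  pose proof (Rmin_l delta (eps / (1 + Rabs l))). pose proof (Rmin_r delta (eps / (1 + Rabs l))).
  specialize (Hd (Rmax 0 s) (Rmax_l 0 s) ltac:(lra)). rewrite Rmult_1_l in Hd.
  assert (B : Rabs (f (Rmax 0 s) - f t) <= (1 + Rabs l) * Rabs (s - t)).
  { replace (f (Rmax 0 s) - f t) with ((f (Rmax 0 s) - f t - (Rmax 0 s - t) * l) + (Rmax 0 s - t) * l) by ring.
    apply Rle_trans with (1 := Rabs_triang _ _). rewrite Rabs_mult.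
    pose proof (Rabs_pos l). nra. }
  apply Rle_lt_trans with (1 := B).
  apply Rlt_le_trans with ((1 + Rabs l) * (eps / (1 + Rabs l))).
  - apply Rmult_lt_compat_l; [exact Hl | lra].
  - right. field. lra.
Qed.

Definition backward (rho : R) (v : nat -> R) (n : nat) : R :=
  INR n / (INR n + 1) * v (n - 1)%nat - (1 + rho / (INR n + 1)) * v n + rho / (INR n + 1) * v (n + 1)%nat.

(** The row vector [(n+1) c_n] is a left eigenvector of the backward matrix: this
    is the equation of its column [n], where [PS_incr_1 c n] is [c_{n-1}] and [0] for
    [n = 0]. *)
Definition left_eigenvector (rho nu : R) (c : nat -> R) : Prop :=
  forall n, INR (n + 1) * c (n + 1)%nat - (INR n + 1 + rho) * c n + rho * PS_incr_1 c n
    = nu * ((INR n + 1) * c n).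

(** A truncated left eigenvector satisfies the eigenvalue equation up to two
    boundary terms at the truncation level. *)
Lemma backward_summation_by_parts rho nu c v N : left_eigenvector rho nu c ->
  sum_n (fun n => (INR n + 1) * c n * backward rho v n) N =
  nu * sum_n (fun n => (INR n + 1) * c n * v n) N
  + (rho * c N * v (N + 1)%nat - INR (N + 1) * c (N + 1)%nat * v N).
Proof.
  intros H.
  assert (T : forall n, (INR n + 1) * c n * backward rho v n =
    INR n * c n * v (n - 1)%nat - (INR n + 1 + rho) * c n * v n + rho * c n * v (n + 1)%nat).
  { intros n. unfold backward. field. pose proof (pos_INR n). lra. }
  induction N as [|N IH].
  - rewrite !sum_O, T. specialize (H 0%nat). simpl in *. unfold zero in H; simpl in H. nra.
  - rewrite !sum_n_succ, IH, T.
    specialize (H (S N)). change (PS_incr_1 c (S N)) with (c N) in H.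
    replace (S N - 1)%nat with N by lia.
    replace (N + 1)%nat with (S N) in * by lia. replace (S N + 1)%nat with (S (S N)) in * by lia.
    assert (E : INR (S (S N)) * c (S (S N)) = nu * ((INR (S N) + 1) * c (S N)) + (INR (S N) + 1 + rho) * c (S N) - rho * c N) by lra.
    rewrite E. as_real. ring.
Qed.

Lemma mode_coef_left_eigenvector rho k d : char_root rho k d -> left_eigenvector rho (d - 1) (mode_coef rho d k).
Proof.
  intros [Q _] n. pose proof (mode_coef_rec rho d k n) as H.
  replace (rho * d + INR (S k) * d ^ 2) with rho in H by lra.
  lra.
Qed.

Lemma density_backward (rho : R) (V p : nat -> R -> R)
  (HV : is_sojourn_tail rho V) (Hp : is_sojourn_density V p) n t :
  0 <= t -> p n t = - backward rho (fun n => V n t) n.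
Proof.
  intros Ht.
  pose proof (is_derive_nonneg_unique _ _ _ _ Ht (Hp n t Ht) (sojourn_tail_ode _ _ HV n t Ht)) as E.
  unfold backward. lra.
Qed.

Lemma density_0 (rho : R) (V p : nat -> R -> R)
  (HV : is_sojourn_tail rho V) (Hp : is_sojourn_density V p) n :
  p n 0 = / (INR n + 1).
Proof.
  rewrite (density_backward rho V p HV Hp) by lra. unfold backward.
  rewrite !(sojourn_tail_init _ _ HV). field. pose proof (pos_INR n). lra.
Qed.

Lemma density_bound (rho : R) (V p : nat -> R -> R)
  (Hrho : 0 < rho) (HV : is_sojourn_tail rho V) (Hp : is_sojourn_density V p) n t :
  0 <= t -> Rabs (p n t) <= 2 + 2 * rho.
Proof.
  intros Ht. rewrite (density_backward rho V p HV Hp) by exact Ht. unfold backward.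
  pose proof (sojourn_tail_bounded _ _ HV (n - 1) t Ht).
  pose proof (sojourn_tail_bounded _ _ HV n t Ht).
  pose proof (sojourn_tail_bounded _ _ HV (n + 1) t Ht).
  pose proof (pos_INR n) as Hn.
  assert (A : 0 <= INR n / (INR n + 1) <= 1).
  { split; [apply Rdiv_le_0_compat; lra | apply Rle_div_l; lra]. }
  assert (B : 0 <= rho / (INR n + 1) <= rho).
  { split; [apply Rdiv_le_0_compat; lra | apply Rle_div_l; nra]. }
  set (a := INR n / _) in *. set (b := rho / _) in *.
  apply Rabs_le. split; nra.
Qed.

(** The truncated pairing [Y_N] of the eigenvector with [V] satisfies
    [Y_N' = nu Y_N + b_N] with boundary terms [b_N] tending to [0] uniformly in time.
    The mean value theorem for [e^{-nu s} Y_N(s)] then gives [Y(t) = e^{nu t} Y(0)]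
    in the limit, without differentiating an infinite series.  The pairing with
    [p = -V'] is [-nu Y], whose value at [t = 0] is [sum_n c_n]. *)
Lemma eigen_functional (rho : R) (V p : nat -> R -> R)
  (Hrho : 0 < rho) (HV : is_sojourn_tail rho V) (Hp : is_sojourn_density V p) nu c t :
  0 <= t -> left_eigenvector rho nu c ->
  ex_series (fun n => (INR n + 1) * Rabs (c n)) ->
  is_series (fun n => (INR n + 1) * c n * p n t) (exp (nu * t) * Series c).
Proof.
  intros Ht He Hc.
  set (Y := fun N s => sum_n (fun n => (INR n + 1) * c n * V n s) N).
  set (b := fun N s => rho * c N * V (N + 1)%nat s - INR (N + 1) * c (N + 1)%nat * V N s).
  set (beta := fun N => rho * ((INR N + 1) * Rabs (c N)) + (INR (N + 1) + 1) * Rabs (c (N + 1)%nat)).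
  assert (Hbeta : is_lim_seq beta 0).
  { pose proof (ex_series_lim_0 _ Hc) as L.
    replace 0 with (rho * 0 + 0) by ring.
    apply is_lim_seq_plus'.
    - apply (is_lim_seq_scal_l _ rho 0), L.
    - apply (is_lim_seq_ext (fun N => (INR (S N) + 1) * Rabs (c (S N)))).
      + intros N; now rewrite Nat.add_1_r.
      + now apply (is_lim_seq_incr_1 (fun N => (INR N + 1) * Rabs (c N))). }
  assert (Hb : forall N s, 0 <= s -> Rabs (b N s) <= beta N).
  { intros N s Hs. unfold b, beta.
    pose proof (sojourn_tail_bounded _ _ HV N s Hs) as B0.
    pose proof (sojourn_tail_bounded _ _ HV (N + 1) s Hs) as B1.
    pose proof (pos_INR N) as P0. pose proof (pos_INR (N + 1)) as P1.
    unfold Rminus. apply Rle_trans with (1 := Rabs_triang _ _).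
    rewrite Rabs_Ropp, !Rabs_mult, (Rabs_pos_eq (V _ _)), (Rabs_pos_eq (V N s)), (Rabs_pos_eq rho), (Rabs_pos_eq (INR _)) by lra.
    pose proof (Rabs_pos (c N)) as Q0. pose proof (Rabs_pos (c (N + 1)%nat)) as Q1.
    apply Rplus_le_compat.
    - rewrite Rmult_assoc. apply Rmult_le_compat_l; [lra|].
      rewrite Rmult_comm. apply Rmult_le_compat_r; lra.
    - apply Rle_trans with (INR (N + 1) * Rabs (c (N + 1)%nat) * 1).
      + apply Rmult_le_compat_l; [now apply Rmult_le_pos | lra].
      + nra. }
  assert (DY : forall N s, 0 < s -> is_derive (Y N) s (nu * Y N s + b N s)).
  { intros N s Hs. unfold Y, b.
    rewrite <- (backward_summation_by_parts rho nu c (fun n => V n s) N He).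
    apply (is_derive_sum_n (K:=R_AbsRing)(V:=R_NormedModule)). intros n _.
    apply is_derive_scal.
    apply is_derive_nonneg_interior; [exact Hs|].
    apply (sojourn_tail_ode _ _ HV n s); lra. }
  assert (CY : forall N s, 0 <= s -> continuity_pt (fun s => Y N (Rmax 0 s)) s).
  { intros N s Hs. unfold Y. induction N as [|N IH].
    - apply (continuity_pt_ext (fun s => (INR 0 + 1) * c 0%nat * V 0%nat (Rmax 0 s))).
      + intros x. now rewrite sum_O.
      + apply (continuity_pt_scal (fun s => V 0%nat (Rmax 0 s))).
        eapply is_derive_nonneg_continuity; [exact Hs | apply (Hp 0%nat s Hs)].
    - apply (continuity_pt_ext (fun s => sum_n (fun n => (INR n + 1) * c n * V n (Rmax 0 s)) N + (INR (S N) + 1) * c (S N) * V (S N) (Rmax 0 s))).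
      + intros x. now rewrite sum_Sn.
      + apply continuity_pt_plus; [exact IH|].
        apply (continuity_pt_scal (fun s => V (S N) (Rmax 0 s))).
        eapply is_derive_nonneg_continuity; [exact Hs | apply (Hp (S N) s Hs)]. }
  assert (Est : forall N, Rabs (exp (- nu * t) * Y N t - Y N 0) <= t * exp (Rabs nu * t) * beta N).
  { intros N.
    destruct (MVT_gen (fun s => exp (- nu * s) * Y N (Rmax 0 s)) 0 t (fun s => exp (- nu * s) * b N (Rmax 0 s))) as [x [Hx E]].
    - rewrite Rmin_left, Rmax_right by lra. intros s Hs.
      apply (is_derive_ext_loc (fun s => exp (- nu * s) * Y N s)).
      + exists (mkposreal s (proj1 Hs)). intros y Hy.
        change (Rabs (y - s) < s) in Hy. apply Rabs_def2 in Hy.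
        rewrite Rmax_right by lra. reflexivity.
      + rewrite Rmax_right by lra.
        replace (exp (- nu * s) * b N s) with (- nu * exp (- nu * s) * Y N s + exp (- nu * s) * (nu * Y N s + b N s)) by ring.
        apply (is_derive_mult (fun s => exp (- nu * s)) (Y N)).
        * auto_derive; [easy|]. ring.
        * apply DY, Hs.
        * apply Rmult_comm.
    - rewrite Rmin_left, Rmax_right by lra. intros s Hs.
      apply (continuity_pt_mult (fun s => exp (- nu * s)) (fun s => Y N (Rmax 0 s))).
      + apply continuity_pt_filterlim, (ex_derive_continuous (fun s => exp (- nu * s))). auto_derive; easy.
      + apply CY; lra.
    - rewrite Rmin_left, Rmax_right in Hx by lra.
      rewrite (Rmax_right 0 t), (Rmax_right 0 0), (Rmax_right 0 x) in E by lra.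
      rewrite Rmult_0_r, exp_0, Rmult_1_l, Rminus_0_r in E. rewrite E.
      rewrite !Rabs_mult, (Rabs_pos_eq t), (Rabs_pos_eq (exp _)) by (try apply Rlt_le, exp_pos; lra).
      rewrite (Rmult_comm t), (Rmult_assoc (exp (Rabs nu * t))), (Rmult_comm t), <- Rmult_assoc.
      apply Rmult_le_compat_r; [exact Ht|].
      apply Rmult_le_compat; [apply Rlt_le, exp_pos | apply Rabs_pos | | apply Hb; lra].
      assert (X : - nu * x <= Rabs nu * t).
      { apply Rle_trans with (Rabs nu * x).
        - apply Rmult_le_compat_r; [lra|]. rewrite <- Rabs_Ropp. apply Rle_abs.
        - apply Rmult_le_compat_l; [apply Rabs_pos | lra]. }
      destruct X as [X| ->]; [left; now apply exp_increasing | apply Rle_refl]. }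
  assert (EY : forall s, 0 <= s -> ex_series (fun n => (INR n + 1) * c n * V n s)).
  { intros s Hs. apply ex_series_dominated with (2 := Hc). intros n.
    pose proof (sojourn_tail_bounded _ _ HV n s Hs) as B. pose proof (pos_INR n).
    rewrite !Rabs_mult, (Rabs_pos_eq (V n s)), (Rabs_pos_eq (INR n + 1)) by lra.
    rewrite <- (Rmult_1_r (_ * Rabs (c n))) at 2. apply Rmult_le_compat_l; [|lra].
    apply Rmult_le_pos; [lra | apply Rabs_pos]. }
  set (YS := fun s => Series (fun n => (INR n + 1) * c n * V n s)).
  assert (LY : forall s, 0 <= s -> is_lim_seq (fun N => Y N s) (YS s)).
  { intros s Hs. exact (Series_correct _ (EY s Hs)). }
  assert (Lb : forall s, 0 <= s -> is_lim_seq (fun N => b N s) 0).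
  { intros s Hs. apply is_lim_seq_abs_0.
    apply (is_lim_seq_le_le (fun _ => 0) _ beta); [|apply is_lim_seq_const | exact Hbeta].
    intros N. split; [apply Rabs_pos | now apply Hb]. }
  assert (Hsum : forall s, 0 <= s -> is_series (fun n => (INR n + 1) * c n * p n s) (- (nu * YS s))).
  { intros s Hs.
    change (is_lim_seq (sum_n (fun n => (INR n + 1) * c n * p n s)) (- (nu * YS s))).
    apply (is_lim_seq_ext (fun N => - (nu * Y N s + b N s))).
    - intros N. unfold Y, b.
      rewrite <- (backward_summation_by_parts rho nu c (fun n => V n s) N He).
      transitivity (-1 * sum_n (fun n => (INR n + 1) * c n * backward rho (fun n => V n s) n) N); [as_real; ring|].
      rewrite !sum_n_Reals, scal_sum. apply sum_eq. intros n _. rewrite (density_backward rho V p HV Hp) by exact Hs. ring.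
    - replace (- (nu * YS s)) with (- (nu * YS s + 0)) by ring.
      apply (is_lim_seq_opp _ (nu * YS s + 0)), is_lim_seq_plus'; [|now apply Lb].
      apply (is_lim_seq_scal_l _ nu (YS s)), LY, Hs. }
  assert (Hprop : exp (- nu * t) * YS t = YS 0).
  { apply Rminus_diag_uniq.
    assert (L1 : is_lim_seq (fun N => exp (- nu * t) * Y N t - Y N 0) (exp (- nu * t) * YS t - YS 0)).
    { apply is_lim_seq_minus'; [|apply LY; lra].
      apply (is_lim_seq_scal_l _ (exp (- nu * t)) (YS t)), LY, Ht. }
    assert (L2 : is_lim_seq (fun N => exp (- nu * t) * Y N t - Y N 0) 0).
    { apply is_lim_seq_abs_0.
      apply (is_lim_seq_le_le (fun _ => 0) _ (fun N => t * exp (Rabs nu * t) * beta N)).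
      - intros N. split; [apply Rabs_pos | apply Est].
      - apply is_lim_seq_const.
      - replace (Finite 0) with (Rbar_mult (t * exp (Rabs nu * t)) 0) by (simpl; f_equal; ring).
        apply is_lim_seq_scal_l, Hbeta. }
    apply is_lim_seq_unique in L1. apply is_lim_seq_unique in L2. rewrite L1 in L2.
    now injection L2. }
  assert (H0 : - (nu * YS 0) = Series c).
  { rewrite <- (is_series_unique _ _ (Hsum 0 (Rle_refl 0))). apply Series_ext. intros n.
    rewrite (density_0 rho V p HV Hp). field. pose proof (pos_INR n). lra. }
  replace (exp (nu * t) * Series c) with (- (nu * YS t)); [now apply Hsum|].
  rewrite <- H0, <- Hprop.
  replace (- nu * t) with (- (nu * t)) by ring. rewrite exp_Ropp. field.
  apply Rgt_not_eq, exp_pos.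
Qed.

(** * The spectral expansion *)

Lemma succ_le_pow2 n : INR n + 1 <= 2 ^ n.
Proof.
  induction n as [|n IH]; [simpl; lra|].
  rewrite S_INR, <- tech_pow_Rmult. pose proof (pos_INR n). lra.
Qed.

Lemma weighted_of_l1_norm_le a M : l1_norm_le 2 a M ->
  ex_series (fun n => (INR n + 1) * Rabs (a n)) /\
  (forall N, sum_n (fun n => (INR n + 1) * Rabs (a n)) N <= M) /\ Rabs (Series a) <= M.
Proof.
  intros [E H].
  assert (W : forall n, 0 <= (INR n + 1) * Rabs (a n) <= Rabs (a n) * 2 ^ n).
  { intros n. pose proof (Rabs_pos (a n)). pose proof (succ_le_pow2 n). pose proof (pos_INR n). nra. }
  assert (Ew : ex_series (fun n => (INR n + 1) * Rabs (a n))).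
  { apply ex_series_dominated with (2 := E). intros n. rewrite Rabs_pos_eq; apply W. }
  assert (Sw : Series (fun n => (INR n + 1) * Rabs (a n)) <= M).
  { apply Rle_trans with (2 := H). now apply Series_le. }
  split; [exact Ew|]. split.
  - intros N. rewrite (Series_split _ N Ew) in Sw.
    assert (0 <= Series (fun k => (INR (S N + k) + 1) * Rabs (a (S N + k)%nat))); [|lra].
    apply Series_nonneg; [intros k; apply W|].
    now apply (ex_series_incr_n (fun n => (INR n + 1) * Rabs (a n)) (S N)).
  - apply Rle_trans with (2 := Sw). apply Rabs_Series_dominated; [|exact Ew].
    intros n. pose proof (Rabs_pos (a n)). pose proof (pos_INR n). nra.
Qed.

Lemma mode_coef_sum rho k d : Series (mode_coef rho d k) = mode_gf rho d k 1.
Proof.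
  apply is_series_unique.
  apply (is_series_ext (fun n => mode_coef rho d k n * 1 ^ n)).
  - intros n. now rewrite pow1, Rmult_1_r.
  - apply entire_is_series, entire_mode_coef.
Qed.

Lemma eigen_mode rho V p k d t : 0 < rho -> is_sojourn_tail rho V -> is_sojourn_density V p ->
  0 <= t -> char_root rho k d ->
  is_series (fun n => (INR n + 1) * mode_coef rho d k n * p n t) (exp ((d - 1) * t) * mode_gf rho d k 1).
Proof.
  intros Hrho HV Hp Ht Hd. rewrite <- mode_coef_sum.
  apply (eigen_functional rho V p Hrho HV Hp); auto.
  - now apply mode_coef_left_eigenvector.
  - eapply weighted_of_l1_norm_le, mode_norm_le; eassumption.
Qed.

(** The contribution [e^rho * spectral_term] of one root to the expansion. *)
Definition mode_term (rho t : R) (k : nat) (d : R) : R :=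
  borel_weight k * (mode_weight d * (exp ((d - 1) * t) * mode_gf rho d k 1)).

Lemma mode_term_summable rho t (d : nat -> R) : 0 < rho -> 0 <= t ->
  (forall k, char_root rho k (d k)) -> ex_series (fun k => mode_term rho t k (d k)).
Proof.
  intros Hrho Ht Hd.
  apply ex_series_dominated with (fun k => mode_norm_bound rho * borel_weight k).
  - intros k. destruct (Hd k) as [_ [_ L]].
    destruct (weighted_of_l1_norm_le _ _ (mode_norm_le rho k _ Hrho (Hd k))) as [_ [_ B]].
    rewrite mode_coef_sum in B. unfold mode_term.
    rewrite !Rabs_mult, (Rabs_pos_eq (borel_weight k)), (Rabs_pos_eq (exp _)) by (apply borel_weight_pos || apply Rlt_le, exp_pos).
    rewrite (Rmult_comm (mode_norm_bound rho)). apply Rmult_le_compat_l; [apply borel_weight_pos|].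
    pose proof (mode_weight_bound _ L) as B1.
    assert (B2 : exp ((d k - 1) * t) <= 1).
    { rewrite <- exp_0 at 2. destruct (Req_dec ((d k - 1) * t) 0) as [->|N]; [apply Rle_refl|].
      left. apply exp_increasing. nra. }
    pose proof (exp_pos ((d k - 1) * t)). pose proof (Rabs_pos (mode_weight (d k))).
    pose proof (Rabs_pos (mode_gf rho (d k) k 1)) as B0.
    rewrite <- Rmult_assoc. rewrite <- (Rmult_1_l (mode_norm_bound rho)).
    apply Rmult_le_compat; auto; nra.
  - apply (ex_series_scal_l (mode_norm_bound rho) borel_weight), borel_weight_summable.
Qed.

Theorem theorem2p6 (rho : R) (V p : nat -> R -> R)
  (Hrho : 0 < rho)
  (HV : is_sojourn_tail rho V)
  (Hp : is_sojourn_density V p)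
  (t : R) (Ht : 0 <= t) :
  ex_series (p_PS_term rho p t) /\
  ex_series (fun k => spectral_term rho (nu_plus rho) t (k + 1)) /\
  ex_series (fun k => spectral_term rho (nu_minus rho) t (k + 1)) /\
  p_PS rho p t =
    Series (fun k => spectral_term rho (nu_plus rho) t (k + 1)) +
    Series (fun k => spectral_term rho (nu_minus rho) t (k + 1)).
Proof.
  pose proof (fun k => root_plus_char rho k Hrho) as Rp.
  pose proof (fun k => root_minus_char rho k Hrho) as Rm.
  pose proof (mode_term_summable rho t _ Hrho Ht Rp) as Sp.
  pose proof (mode_term_summable rho t _ Hrho Ht Rm) as Sm.
  set (mp := fun k => mode_term rho t k (root_plus rho k)) in *.
  set (mm := fun k => mode_term rho t k (root_minus rho k)) in *.
  assert (Tp : forall k, spectral_term rho (nu_plus rho) t (k + 1) = exp (- rho) * mp k).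
  { intros k. apply spectral_term_eq; [apply Rp | apply nu_plus_root]. }
  assert (Tm : forall k, spectral_term rho (nu_minus rho) t (k + 1) = exp (- rho) * mm k).
  { intros k. apply spectral_term_eq; [apply Rm | apply nu_minus_root]. }
  assert (Main : is_series (fun n => rho ^ n / INR (fact n) * p n t) (Series (fun k => mp k + mm k))).
  { set (mix := fun k n => mode_weight (root_plus rho k) * mode_coef rho (root_plus rho k) k n +
                           mode_weight (root_minus rho k) * mode_coef rho (root_minus rho k) k n).
    set (P := 2 + 2 * rho). set (M := mode_norm_bound rho).
    apply (is_series_swap (fun n k => (INR n + 1) * p n t * (borel_weight k * mix k n))) with (g := fun k => P * (2 * M) * borel_weight k).
    - intros n.
      replace (rho ^ n / INR (fact n) * p n t) with ((INR n + 1) * p n t * (rho ^ n / INR (fact (n + 1)))).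
      + exact (is_series_scal_l _ _ _ (eigen_expansion rho n Hrho)).
      + rewrite Nat.add_1_r, fact_simpl, mult_INR, S_INR. field.
        split; [apply INR_fact_neq_0 | pose proof (pos_INR n); lra].
    - intros k.
      apply (is_series_ext (fun n => borel_weight k * mode_weight (root_plus rho k) * ((INR n + 1) * mode_coef rho (root_plus rho k) k n * p n t)
        + borel_weight k * mode_weight (root_minus rho k) * ((INR n + 1) * mode_coef rho (root_minus rho k) k n * p n t))).
      + intros n. unfold mix. as_real. ring.
      + replace (mp k + mm k) with
         (borel_weight k * mode_weight (root_plus rho k) * (exp ((root_plus rho k - 1) * t) * mode_gf rho (root_plus rho k) k 1)
          + borel_weight k * mode_weight (root_minus rho k) * (exp ((root_minus rho k - 1) * t) * mode_gf rho (root_minus rho k) k 1))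
          by (unfold mp, mm, mode_term; ring).
        apply (is_series_plus (K:=R_AbsRing)(V:=R_NormedModule)).
        * exact (is_series_scal_l _ _ _ (eigen_mode _ _ _ _ _ _ Hrho HV Hp Ht (Rp k))).
        * exact (is_series_scal_l _ _ _ (eigen_mode _ _ _ _ _ _ Hrho HV Hp Ht (Rm k))).
    - intros N k.
      destruct (weighted_of_l1_norm_le _ _ (mode_norm_le rho k _ Hrho (Rp k))) as [_ [Bp _]].
      destruct (weighted_of_l1_norm_le _ _ (mode_norm_le rho k _ Hrho (Rm k))) as [_ [Bm _]].
      specialize (Bp N). specialize (Bm N). fold M in Bp, Bm.
      apply Rle_trans with (P * borel_weight k * (sum_n (fun n => (INR n + 1) * Rabs (mode_coef rho (root_plus rho k) k n)) N
         + sum_n (fun n => (INR n + 1) * Rabs (mode_coef rho (root_minus rho k) k n)) N)).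
      + rewrite !sum_n_Reals, <- plus_sum, scal_sum. apply sum_Rle. intros n _.
        pose proof (density_bound rho V p Hrho HV Hp n t Ht) as B. fold P in B.
        destruct (Rp k) as [_ [_ L1]]. destruct (Rm k) as [_ [_ L2]].
        apply mode_weight_bound in L1. apply mode_weight_bound in L2.
        pose proof (pos_INR n) as Hn. pose proof (borel_weight_pos k) as Htau.
        rewrite !Rabs_mult, (Rabs_pos_eq (borel_weight k)), (Rabs_pos_eq (INR n + 1)) by lra.
        assert (Bmix : Rabs (mix k n) <= Rabs (mode_coef rho (root_plus rho k) k n) + Rabs (mode_coef rho (root_minus rho k) k n)).
        { unfold mix. apply Rle_trans with (1 := Rabs_triang _ _). rewrite !Rabs_mult.
          apply Rplus_le_compat; rewrite <- (Rmult_1_l (Rabs (mode_coef _ _ _ _))) at 2;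
            apply Rmult_le_compat_r; auto; apply Rabs_pos. }
        replace ((INR n + 1) * Rabs (p n t) * (borel_weight k * Rabs (mix k n)))
          with ((INR n + 1) * borel_weight k * (Rabs (p n t) * Rabs (mix k n))) by ring.
        replace (((INR n + 1) * Rabs (mode_coef rho (root_plus rho k) k n) + (INR n + 1) * Rabs (mode_coef rho (root_minus rho k) k n)) * (P * borel_weight k))
          with ((INR n + 1) * borel_weight k * (P * (Rabs (mode_coef rho (root_plus rho k) k n) + Rabs (mode_coef rho (root_minus rho k) k n)))) by ring.
        apply Rmult_le_compat_l; [apply Rmult_le_pos; lra|].
        apply Rmult_le_compat; auto; apply Rabs_pos.
      + replace (P * (2 * M) * borel_weight k) with (P * borel_weight k * (M + M)) by ring.
        apply Rmult_le_compat_l; [|lra]. apply Rmult_le_pos; [unfold P; lra | apply borel_weight_pos].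
    - apply (ex_series_scal_l (P * (2 * M)) borel_weight), borel_weight_summable. }
  assert (Hps : is_series (p_PS_term rho p t) (exp (- rho) * Series (fun k => mp k + mm k))).
  { apply (is_series_ext (fun n => exp (- rho) * (rho ^ n / INR (fact n) * p n t))).
    - intros n. unfold p_PS_term. as_real. ring.
    - exact (is_series_scal_l _ _ _ Main). }
  split; [eexists; exact Hps|]. split; [|split].
  - apply (ex_series_ext (fun k => exp (- rho) * mp k)); [intros k; symmetry; apply Tp|].
    apply (ex_series_scal_l (exp (- rho)) mp), Sp.
  - apply (ex_series_ext (fun k => exp (- rho) * mm k)); [intros k; symmetry; apply Tm|].
    apply (ex_series_scal_l (exp (- rho)) mm), Sm.
  - unfold p_PS. rewrite (is_series_unique _ _ Hps), (Series_ext _ _ Tp), (Series_ext _ _ Tm).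
    rewrite !Series_scal_l, Series_plus by assumption. ring.
Qed.
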